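(* Suppose that the Basic Assumptions (a)-(c) hold with constants $f_{\mathrm{low}}$, $L_1>0$, $\sigma>0$ and $\alpha\in(1,2]$, and define $$M_{1,\alpha} := 2\big(f(x^0) - f_{\mathrm{low}} + 3\sigma^\alpha + L_1 + (\alpha-1)(2/\alpha)^{\alpha/(\alpha-1)} + 3L_1^\alpha\big).$$ Let $\{x^k\}$ be generated by the normalized SFOM with Polyak momentum with input parameters $$\eta_k=\frac{1}{(k+1)^{(2\alpha-1)/(3\alpha-2)}},\qquad \theta_k=\frac{1}{(k+1)^{\alpha/(3\alpha-2)}}\qquad\forall k\ge0.$$ Then, for any $\epsilon \in (0,1)$, it holds that $\mathbb{E}[\|\nabla f(x^{\iota_K})\|]\le \epsilon$ for all integers $K$ satisfying $$K\ge\max\Big\{\Big(\frac{2(3\alpha-2)M_{1,\alpha}}{(\alpha-1)\epsilon}\ln\Big(\frac{2(3\alpha-2)M_{1,\alpha}}{(\alpha-1)\epsilon}\Big)\Big)^{(3\alpha-2)/(\alpha-1)},3\Big\},$$ where $\iota_K$ is uniformly drawn from $\{0,\ldots,K-1\}$.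
   Context: Setting. $\|\cdot\|$ is the Euclidean norm on $\mathbb{R}^n$. The function $f:\mathbb{R}^n\to\mathbb{R}$ is continuously differentiable and the problem $\min_{x\in\mathbb{R}^n} f(x)$ has at least one optimal solution. $\xi$ is a random variable with sample space $\Xi$, and $G:\mathbb{R}^n\times\Xi\to\mathbb{R}^n$ is a stochastic gradient estimator. Basic Assumptions. (a) There is a finite $f_{\mathrm{low}}$ with $f(x)\ge f_{\mathrm{low}}$ for all $x\in\mathbb{R}^n$. (b) There is $L_1>0$ with $\|\nabla f(x)-\nabla f(y)\|\le L_1\|x-y\|$ for all $x,y\in\mathbb{R}^n$. (c) $\mathbb{E}[G(x;\xi)]=\nabla f(x)$ and $\mathbb{E}[\|G(x;\xi)-\nabla f(x)\|^\alpha]\le\sigma^\alpha$ for all $x\in\mathbb{R}^n$, for some $\sigma>0$ and $\alpha\in(1,2]$. Normalized SFOM with Polyak momentum. Input: a starting point $x^0\in\mathbb{R}^n$, step sizes $\{\eta_k\}_{k\ge0}\subset(0,+\infty)$, weights $\{\theta_k\}_{k\ge0}\subset(0,1]$. Initialize $m^{-1}=0$, $\theta_{-1}=1$. For $k=0,1,2,\ldots$: $m^k=(1-\theta_{k-1})m^{k-1}+\theta_{k-1}G(x^k;\xi^k)$ and $x^{k+1}=x^k-\eta_k m^k/\|m^k\|$, where $\{\xi^k\}$ is a sequence of independently drawn samples of $\xi$. The iteration is understood to be well defined, i.e. $m^k\ne0$ for all $k$. The index $\iota_K$ is drawn independently of the algorithm's samples, so $\mathbb{E}[\|\nabla f(x^{\iota_K})\|]=\frac1K\sum_{k=0}^{K-1}\mathbb{E}[\|\nabla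 f(x^k)\|]$. *)

(* Defs.v *)
From HB Require Import structures.
From mathcomp Require Import all_boot all_order all_algebra finmap.
From mathcomp Require Import all_classical all_reals all_analysis.

Set Implicit Arguments.
Unset Strict Implicit.
Unset Printing Implicit Defensive.

Import Order.TTheory GRing.Theory Num.Theory.
Import numFieldNormedType.Exports.

Local Open Scope classical_set_scope.
Local Open Scope ring_scope.

Section Euclidean_space.
Context {R : realType} {n : nat}.

(* The library's norm on ['rV[R]_n] is the sup norm, hence this definition. *)
Definition enorm (v : 'rV[R]_n) : R := Num.sqrt (\sum_(i < n) v 0 i ^+ 2).

Definition grad (f : 'rV[R]_n -> R) (x : 'rV[R]_n) : 'rV[R]_n :=
  \row_(i < n) 'D_(delta_mx 0 i) f x.

Definition cont_diff (f : 'rV[R]_n -> R) : Prop :=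
  (forall x, differentiable f x) /\ continuous (grad f).

Definition borel_rV := g_sigma_algebraType (@open 'rV[R]_n).

End Euclidean_space.

Arguments borel_rV : clear implicits.

Section independence.
Context d (T : measurableType d) (R : realType) (P : probability T R).

Definition mutually_independent (I : choiceType) (F : I -> set_system T) :=
  forall (J : {fset I}) (E : I -> set T),
    (forall i, i \in J -> F i (E i)) ->
    P (\bigcap_(i in [set` J]) E i) = (\prod_(i <- J) P (E i))%E.

Definition independent2 (F1 F2 : set_system T) :=
  forall A B, F1 A -> F2 B -> P (A `&` B) = (P A * P B)%E.

(* sigma(X) *)
Definition sigma_rv d' (T' : measurableType d') (X : T -> T') : set_system T :=
  preimage_set_system setT X measurable.

(* sigma(X_0, X_1, ...) *)
Definition sigma_seq d' (T' : measurableType d') (X : nat -> T -> T') :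
    set_system T :=
  <<s \bigcup_k sigma_rv (X k) >>.

Definition same_law d' (T' : measurableType d') (X Y : {RV P >-> T'}) :=
  forall A, measurable A -> distribution P X A = distribution P Y A.

Definition uniform_below (K : nat) (iota : {RV P >-> nat}) :=
  forall k, (k < K)%N -> distribution P iota [set k] = (K%:R^-1)%:E.

End independence.

Section normalized_sfom.
Context {R : realType} {n : nat} {Xi : Type}.
Variables (G : 'rV[R]_n -> Xi -> 'rV[R]_n) (x0 : 'rV[R]_n).
Variables (eta theta : nat -> R).
Variable xi : nat -> Xi.

(* theta_{k-1}, with theta_{-1} = 1 *)
Definition theta_prev (k : nat) : R := if k is j.+1 then theta j else 1.

Definition momentum (k : nat) (x mprev : 'rV[R]_n) : 'rV[R]_n :=
  (1 - theta_prev k) *: mprev + theta_prev k *: G x (xi k).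

(* The pair (x^k, m^{k-1}) along the sample path [xi], with m^{-1} = 0. *)
Fixpoint sfom_state (k : nat) : 'rV[R]_n * 'rV[R]_n :=
  if k is j.+1 then
    let: (x, mprev) := sfom_state j in
    let m := momentum j x mprev in
    (x - (eta j / enorm m) *: m, m)
  else (x0, 0).

Definition sfom_x (k : nat) : 'rV[R]_n := (sfom_state k).1.

(* m^k *)
Definition sfom_m (k : nat) : 'rV[R]_n := (sfom_state k.+1).2.

End normalized_sfom.

Section parameters.
Context {R : realType}.
Variable alpha : R.

Definition eta_ (k : nat) : R :=
  1 / (k.+1%:R `^ ((2 * alpha - 1) / (3 * alpha - 2))).

Definition theta_ (k : nat) : R :=
  1 / (k.+1%:R `^ (alpha / (3 * alpha - 2))).

Definition M1 (f0 flow sigma L1 : R) : R :=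
  2 * (f0 - flow + 3 * sigma `^ alpha + L1
       + (alpha - 1) * (2 / alpha) `^ (alpha / (alpha - 1))
       + 3 * L1 `^ alpha).

Definition K_bound (M eps : R) : R :=
  let c := 2 * (3 * alpha - 2) * M / ((alpha - 1) * eps) in
  Num.max ((c * ln c) `^ ((3 * alpha - 2) / (alpha - 1))) 3.

End parameters.

(* Main.v *)
Require Import Defs.
From HB Require Import structures.
From mathcomp Require Import all_boot all_order all_algebra finmap.
From mathcomp Require Import all_classical all_reals all_analysis.
From mathcomp Require Import measurable_realfun.
From mathcomp Require Import ring lra.

Set Implicit Arguments.
Unset Strict Implicit.
Unset Printing Implicit Defensive.

Import Order.TTheory GRing.Theory Num.Theory.
Import numFieldNormedType.Exports.

Local Open Scope classical_set_scope.
Local Open Scope ring_scope.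

(** The proof follows the momentum error [e_k = m^k - grad f (x^k)] through its
    [alpha]-th moment.

    A normalized step has length at most [eta_k], so along every sample path
    the mean value theorem gives
      [eta_k |grad f (x^k)|
         <= f (x^k) - f (x^(k+1)) + 2 eta_k |e_k| + L eta_k^2]
    ([normalized_step_descent], summed in [path_descent]). What remains is to
    control the terms [eta_k |e_k|] in mean.

    The error obeys
      [e_(k+1) = (1 - theta_k) (e_k + grad f (x^k) - grad f (x^(k+1)))
                 + theta_k (G (x^(k+1); xi^(k+1)) - grad f (x^(k+1)))],
    where the last summand has mean zero given the past. Expanding
      [|u + v|^alpha <= |u|^alpha + c_u <u, v> + 2 |v|^alpha]
    ([powR_enormD]) and integrating over the fresh sample removes the linear
    term: the state before the sample is a function of the earlier samples, hence
    independent of it ([independent_past], [measurable_sfom_state_past]), and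
    Tonelli's theorem ([integral_independent]) lets the state be frozen while
    the sample is integrated. Together with convexity
    of the power ([powR_enorm_contraction]) this is the recursion
      [E|e_(k+1)|^alpha <= (1 - theta_k) E|e_k|^alpha
         + theta_k^(1-alpha) (L eta_k)^alpha + 2 theta_k^alpha sigma^alpha]
    ([mean_errS_noise]).

    Multiply it by the weight [w_k = (k+1)^(-(alpha-1)(2-alpha)/(3 alpha-2))].
    This exponent is the one for which both inhomogeneous terms become multiples
    of [1/(k+1)], and it is also the one for which Young's inequality bounds
    [2 eta_k |e_k|] by [w_k theta_k |e_k|^alpha] plus a multiple of [1/(k+1)].
    As the weights do not increase, the recursion telescopes and bounds the sum
    of [w_k theta_k E|e_k|^alpha] ([weighted_err_sum]). The harmonic sums cost a
    factor [ln K], the smallest step size costs [K^((2 alpha-1)/(3 alpha-2))],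
    and dividing by [K] leaves [M1 K^(-s) ln K] with
    [s = (alpha-1)/(3 alpha-2)] as a bound for the average gradient norm. The
    iteration count of the theorem is where this falls below [eps]
    ([log_threshold]); the average is the mean at the random index because the
    index is independent of the samples ([mean_uniform_index]). *)

(** * Inequalities for real powers *)

Section scalar_inequalities.
Context {R : realType}.
Implicit Types (a b c p r t u x : R).

(** The graph of a concave power lies below its tangent at [1]; here as Young's
    inequality with the second factor equal to [1]. *)
Lemma powR_le_tangent1 u r : 0 <= u -> 0 < r <= 1 -> u `^ r <= r * u + (1 - r).
Proof.
move=> u0 /andP[r0]; rewrite le_eqVlt => /predU1P[->|r1].
  by rewrite powRr1// mul1r subrr addr0.
have r1' : 0 < 1 - r by rewrite subr_gt0.
have := @conjugate_powR R (u `^ r) 1 r^-1 (1 - r)^-1 (powR_ge0 _ _) ler01.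
rewrite !invr_gt0 r0 r1' !invrK subrKC => /(_ isT isT erefl).
by rewrite mulr1 powR1 mul1r -powRrM mulfV ?gt_eqF// powRr1// mulrC.
Qed.

Lemma powR_le_tangent c r t : 0 < c -> 0 < r <= 1 -> 0 <= t ->
  t `^ r <= c `^ r + r * c `^ (r - 1) * (t - c).
Proof.
move=> c0 r01 t0.
have tc : t = c * (t / c) by rewrite mulrC mulfVK// gt_eqF.
have tc0 : 0 <= t / c by rewrite divr_ge0// ltW.
have /andP[r0 _] := r01.
have := powR_le_tangent1 tc0 r01.
rewrite -(ler_pM2l (powR_gt0 r c0)) -powRM ?(ltW c0)// -tc => /le_trans; apply.
rewrite -(mulr_powRB1 (ltW c0) r0).
set z := c `^ (r - 1).
rewrite le_eqVlt; apply/orP; left; apply/eqP; field.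
by rewrite gt_eqF.
Qed.

Lemma young_powRB1 a b p : 0 <= a -> 0 <= b -> 1 < p ->
  p * a `^ (p - 1) * b <= (p - 1) * a `^ p + b `^ p.
Proof.
move=> a0 b0 p1.
have p0 : 0 < p by lra.
have q0 : 0 < p / (p - 1) by rewrite divr_gt0//; lra.
have pn0 : p != 0 by rewrite gt_eqF.
have p1n0 : p - 1 != 0 by rewrite gt_eqF// subr_gt0.
have := @conjugate_powR R b (a `^ (p - 1)) p (p / (p - 1)) b0 (powR_ge0 _ _) p0 q0.
rewrite -powRrM.
have -> : p^-1 + (p / (p - 1))^-1 = 1 by field; rewrite p1n0 pn0.
have -> : (p - 1) * (p / (p - 1)) = p by field.
move=> /(_ erefl); rewrite -(ler_pM2l p0) => H.
apply: le_trans (le_trans H _); rewrite le_eqVlt; apply/orP; left; apply/eqP.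
  by ring.
by field; rewrite p1n0 pn0.
Qed.

(** Young's inequality for the exponents [p] and [p / (p - 1)]. The constant is
    the maximum over [t] of [2 eta t - A t^p] for [eta = A = 1], which is how
    [(alpha - 1) (2 / alpha)^(alpha / (alpha - 1))] enters the complexity
    bound. *)
Lemma young_weighted (eta A t p : R) : 0 <= eta -> 0 < A -> 0 <= t -> 1 < p ->
  2 * eta * t <= A * t `^ p
    + (p - 1) * (2 / p) `^ (p / (p - 1))
      * (eta `^ (p / (p - 1)) * A `^ (- (p - 1)^-1)).
Proof.
move=> eta0 A0 t0 p1.
have p0 : 0 < p by lra.
have q0 : 0 < p / (p - 1) by rewrite divr_gt0//; lra.
have pn0 : p != 0 by rewrite gt_eqF.
have p1n0 : p - 1 != 0 by rewrite gt_eqF// subr_gt0.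
have pA0 : 0 < p * A by rewrite mulr_gt0.
(* The factor [p A] is split so that the first power is exactly [A t^p]. *)
have := @conjugate_powR R ((p * A) `^ p^-1 * t)
  (2 * eta * (p * A) `^ (- p^-1)) p (p / (p - 1)).
rewrite !mulr_ge0 ?powR_ge0// => /(_ isT isT p0 q0).
have -> : p^-1 + (p / (p - 1))^-1 = 1 by field; rewrite p1n0 pn0.
move=> /(_ erefl).
have -> : (p * A) `^ p^-1 * t * (2 * eta * (p * A) `^ - p^-1) = 2 * eta * t.
  rewrite powRN; field; by rewrite gt_eqF// powR_gt0.
move=> /le_trans; apply.
rewrite powRM ?powR_ge0// -powRrM mulVf// powRr1 ?(ltW pA0)//.
rewrite (powRM _ (mulr_ge0 _ eta0) (powR_ge0 _ _))// -powRrM.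
have -> : - p^-1 * (p / (p - 1)) = - (p - 1)^-1 by field; rewrite p1n0 pn0.
rewrite (powRM _ _ eta0)// (powRM _ (ltW p0) (ltW A0)).
rewrite (powRM _ _ (_ : 0 <= p^-1)) ?invr_ge0 ?(ltW p0)//.
have -> : p^-1 `^ (p / (p - 1)) = p^-1 * p `^ (- (p - 1)^-1).
  rewrite -(powR_inv1 (ltW p0)) -powRrM -powRD; last by rewrite pn0 implybT.
  by congr (_ `^ _); field.
rewrite le_eqVlt; apply/orP; left; apply/eqP; field.
by rewrite p1n0 pn0.
Qed.

(** Convexity of the power at [(1 - t) a + t ((1 - t) b / t)]. Giving [b] the
    small weight [t] keeps the factor [1 - t] on [a^p], at the price of
    [t^(1 - p)] on [b^p]. *)
Lemma powR_contraction a b p t : 0 <= a -> 0 <= b -> 1 <= p -> 0 < t <= 1 ->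
  ((1 - t) * (a + b)) `^ p <= (1 - t) * a `^ p + t `^ (1 - p) * b `^ p.
Proof.
move=> a0 b0 p1 /andP[t0 t1].
have p0 : 0 < p by lra.
have t1' : 0 <= 1 - t by lra.
have bt0 : 0 <= b / t by rewrite divr_ge0// ltW.
have c0 : 0 <= (1 - t) * (b / t) by rewrite mulr_ge0.
have s0 : 0 <= 1 - t by [].
have s1 : 1 - t <= 1 by lra.
have := @convex_powR R p p1 (@Itv01 R (1 - t) s0 s1) a ((1 - t) * (b / t)).
rewrite !inE/= !in_itv/= !andbT => /(_ a0 c0).
rewrite [X in X `^ _ <= _ -> _]convRE [X in _ <= X -> _]convRE/= unstable.onemK.
have -> : (1 - t) * a + t * ((1 - t) * (b / t)) = (1 - t) * (a + b).
  by field; rewrite gt_eqF.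
move=> /le_trans; apply; rewrite lerD2l.
rewrite powRM ?divr_ge0 ?(ltW t0)// powRM ?invr_ge0 ?(ltW t0)//.
have -> : t * ((1 - t) `^ p * (b `^ p * t^-1 `^ p)) =
   (1 - t) `^ p * (t `^ (1 - p) * b `^ p).
  rewrite -(powR_inv1 (ltW t0)) -powRrM mulN1r [t `^ (1 - p)]powRD; last first.
    by rewrite (gt_eqF t0) implybT.
  by rewrite powRr1 ?(ltW t0)//; ring.
rewrite ler_piMl ?mulr_ge0 ?powR_ge0//.
have := @ge0_ler_powR R p (ltW p0) (1 - t) 1.
by rewrite !nnegrE powR1; exact.
Qed.


(** The harmonic sum is compared with the logarithm through
    [ln (k+1) - ln k >= 1 / (k+1)], a tangent bound at [k / (k+1)]. *)
Lemma harmonic_le_ln K : (0 < K)%N ->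
  \sum_(k < K) (k.+1%:R^-1 : R) <= 1 + ln K%:R.
Proof.
elim: K => [//|[|K] IH] _.
  by rewrite big_ord_recr big_ord0/= add0r invr1 ln1 addr0.
rewrite big_ord_recr/=; apply: le_trans (lerD (IH isT) (lexx _)) _.
rewrite -addrA lerD2l.
have k0 : 0 < K.+1%:R :> R by rewrite ltr0n.
have k1 : 0 < K.+2%:R :> R by rewrite ltr0n.
have := @le_ln1Dx R (- K.+2%:R^-1).
rewrite ltrN2 invf_lt1// ltr1n => /(_ isT).
have -> : 1 - K.+2%:R^-1 = K.+1%:R / K.+2%:R :> R.
  by have /lt0r_neq0 := k1; rewrite -natr1 => k2; field.
by rewrite ln_div ?posrE// => H; move: H; set z := _.+2%:R^-1 => H; lra.
Qed.

End scalar_inequalities.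

(** * Euclidean geometry *)

Section euclidean.
Context {R : realType} {n : nat}.
Implicit Types (u v w x m : 'rV[R]_n) (p c : R).

Definition dot u v : R := \sum_(i < n) u 0 i * v 0 i.

Lemma dotC u v : dot u v = dot v u.
Proof. by apply: eq_bigr => i _; rewrite mulrC. Qed.

Lemma dotDl u v w : dot (u + v) w = dot u w + dot v w.
Proof. by rewrite -big_split; apply: eq_bigr => i _; rewrite mxE mulrDl. Qed.

Lemma dotZl c u v : dot (c *: u) v = c * dot u v.
Proof. by rewrite mulr_sumr; apply: eq_bigr => i _; rewrite mxE mulrA. Qed.

Lemma dotDr u v w : dot u (v + w) = dot u v + dot u w.
Proof. by rewrite dotC dotDl !(dotC u). Qed.

Lemma dotZr c u v : dot u (c *: v) = c * dot u v.
Proof. by rewrite dotC dotZl dotC. Qed.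

Lemma dotNl u v : dot (- u) v = - dot u v.
Proof. by rewrite -scaleN1r dotZl mulN1r. Qed.

Lemma dotNr u v : dot u (- v) = - dot u v.
Proof. by rewrite dotC dotNl dotC. Qed.

Lemma dot_ge0 u : 0 <= dot u u.
Proof. by apply: sumr_ge0 => i _; rewrite -expr2 sqr_ge0. Qed.

Lemma dot_eq0 u : dot u u = 0 -> u = 0.
Proof.
move=> /eqP; rewrite psumr_eq0; last by move=> i _; rewrite -expr2 sqr_ge0.
move=> /allP u0; apply/rowP => i; rewrite mxE; apply/eqP.
by have := u0 i (mem_index_enum _); rewrite -expr2 sqrf_eq0.
Qed.

Lemma enorm_ge0 u : 0 <= enorm u. Proof. exact: sqrtr_ge0. Qed.

Lemma sqr_enorm u : enorm u ^+ 2 = dot u u.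
Proof.
rewrite sqr_sqrtr; last by apply: sumr_ge0 => i _; rewrite sqr_ge0.
by apply: eq_bigr => i _; rewrite expr2.
Qed.

Lemma enorm_eq0 u : enorm u = 0 -> u = 0.
Proof. by move=> u0; apply: dot_eq0; rewrite -sqr_enorm u0 expr0n. Qed.

Lemma enorm0 : enorm (0 : 'rV[R]_n) = 0.
Proof.
by rewrite /enorm big1 ?sqrtr0// => i _; rewrite mxE expr0n.
Qed.

Lemma enormZ c u : enorm (c *: u) = `|c| * enorm u.
Proof.
apply/eqP; rewrite -(eqrXn2 (ltn0Sn 1)) ?mulr_ge0 ?enorm_ge0//.
by rewrite exprMn !sqr_enorm dotZl dotZr real_normK ?num_real// expr2 mulrA.
Qed.

Lemma enormN u : enorm (- u) = enorm u.
Proof. by rewrite -scaleN1r enormZ normrN1 mul1r. Qed.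

Lemma sqr_enormD u v :
  enorm (u + v) ^+ 2 = enorm u ^+ 2 + 2 * dot u v + enorm v ^+ 2.
Proof. by rewrite !sqr_enorm dotDl !dotDr (dotC v u); ring. Qed.

Lemma cauchy_schwarz u v : dot u v <= enorm u * enorm v.
Proof.
have [u0|u0] := eqVneq (enorm u) 0.
  by rewrite (enorm_eq0 u0) -(scale0r 0) dotZl enormZ normr0 !mul0r.
have [v0|v0] := eqVneq (enorm v) 0.
  by rewrite (enorm_eq0 v0) -(scale0r 0) dotZr enormZ normr0 !(mul0r, mulr0).
have uv0 : 0 < enorm u * enorm v by rewrite mulr_gt0// lt0r enorm_ge0 ?u0 ?v0.
have := dot_ge0 (enorm v *: u - enorm u *: v).
rewrite -sqr_enorm sqr_enormD enormN !enormZ !ger0_norm ?enorm_ge0//.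
rewrite dotNr dotZl dotZr; move: uv0.
move: (enorm u) (enorm v) (dot u v) => a b s; nra.
Qed.

Lemma cauchy_schwarzN u v : - (enorm u * enorm v) <= dot u v.
Proof. by have := cauchy_schwarz (- u) v; rewrite dotNl enormN; lra. Qed.

Lemma enorm_triangle u v : enorm (u + v) <= enorm u + enorm v.
Proof.
rewrite -(@ler_pXn2r _ 2)// ?nnegrE ?addr_ge0 ?enorm_ge0//.
by rewrite sqr_enormD; have := cauchy_schwarz u v; nra.
Qed.

Lemma powR_enorm u p : enorm u `^ p = (enorm u ^+ 2) `^ (p / 2).
Proof.
rewrite -powR_mulrn ?enorm_ge0// -powRrM; congr (_ `^ _); field => //.
Qed.

(** Scalar form of [powR_enormD], with [a], [b] the norms and [s] the inner
    product. The power [p / 2] is concave in the squared norm, so it is bounded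
    by its tangent at the larger of [a^2] and [b^2]. If [b <= a], the tangent
    already has the right linear term; if [a < b], its slope in [s] is corrected
    using [- a b <= s] and Young's inequality. *)
Lemma powR_sqr_add (a b s p : R) : 0 <= a -> 0 <= b -> `|s| <= a * b ->
  1 < p <= 2 -> 0 <= a ^+ 2 + 2 * s + b ^+ 2 ->
  (a ^+ 2 + 2 * s + b ^+ 2) `^ (p / 2) <=
    a `^ p + p * a `^ (p - 2) * s + 2 * b `^ p.
Proof.
move=> a0 b0 sab /andP[p1 p2] t0.
have p0 : 0 < p by lra.
have p01 : 0 < p / 2 <= 1 by apply/andP; split; lra.
have [sN sP] : - (a * b) <= s /\ s <= a * b by move: sab; rewrite ler_norml => /andP.
have sqrpow (z : R) : 0 <= z -> (z ^+ 2) `^ (p / 2) = z `^ p.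
  by move=> z0; rewrite -powR_mulrn// -powRrM; congr (_ `^ _); field => //.
have sqrpow1 (z : R) : 0 <= z -> (z ^+ 2) `^ (p / 2 - 1) = z `^ (p - 2).
  by move=> z0; rewrite -powR_mulrn// -powRrM; congr (_ `^ _); field => //.
have powB2 (z : R) : 0 < z -> z `^ p = z `^ (p - 2) * z ^+ 2.
  move=> z0; rewrite -powR_mulrn ?(ltW z0)// -powRD; last by rewrite (gt_eqF z0) implybT.
  by congr (_ `^ _); ring.
have powB1 (z : R) : 0 < z -> z `^ (p - 1) = z `^ (p - 2) * z.
  move=> z0; rewrite -[X in _ * X]powRr1 ?(ltW z0)// -powRD; last by rewrite (gt_eqF z0) implybT.
  by congr (_ `^ _); ring.
have pow_anti (z y : R) : 0 < z -> z <= y -> y `^ (p - 2) <= z `^ (p - 2).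
  move=> z0 zy; have y0 : 0 < y by exact: lt_le_trans zy.
  rewrite -(opprB 2 p) !powRN lef_pV2 ?posrE ?powR_gt0//.
  by rewrite ge0_ler_powR ?nnegrE ?subr_ge0// ltW.
have [az|aN0] := eqVneq a 0.
  have -> : s = 0 by move: sN sP; rewrite az mul0r; lra.
  rewrite az.
  rewrite powR0 ?gt_eqF// expr0n/= !mulr0 !add0r sqrpow//.
  by have := powR_ge0 b p; lra.
have {aN0} {}a0 : 0 < a by rewrite lt0r aN0.
have [ba|ab] := leP b a.
  have := powR_le_tangent (exprn_gt0 2 a0) p01 t0.
  rewrite (sqrpow a (ltW a0)) (sqrpow1 a (ltW a0)) => /le_trans; apply.
  have [->|bN0] := eqVneq b 0.
    by rewrite powR0 ?gt_eqF// le_eqVlt; apply/orP; left; apply/eqP; field.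
  have {bN0} {}b0 : 0 < b by rewrite lt0r bN0.
  have := pow_anti _ _ b0 ba; have := powR_ge0 a (p - 2); rewrite (powB2 b)//.
  move: (a `^ (p - 2)) (b `^ (p - 2)) => A B A0 AB.
  have : A * b ^+ 2 <= B * b ^+ 2 by rewrite ler_wpM2r ?sqr_ge0.
  have : 0 <= A * b ^+ 2 by rewrite mulr_ge0 ?sqr_ge0.
  nra.
have {}b0 : 0 < b by exact: lt_trans ab.
have := powR_le_tangent (exprn_gt0 2 b0) p01 t0.
rewrite (sqrpow b (ltW b0)) (sqrpow1 b (ltW b0)) => /le_trans; apply.
have := young_powRB1 (ltW a0) (ltW b0) p1.
have := pow_anti _ _ a0 (ltW ab); have := powR_ge0 b (p - 2).
rewrite (powB1 a a0) (powB2 a a0) (powB2 b b0).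
move: (a `^ (p - 2)) (b `^ (p - 2)) => A B B0 BA Y.
have h1 : 0 <= p * (A - B) * (s + a * b).
  by rewrite !mulr_ge0 ?subr_ge0 ?(ltW p0)//; lra.
have h2 : 0 <= (2 - p) * A * a ^+ 2.
  by rewrite mulr_ge0 ?sqr_ge0// mulr_ge0 ?subr_ge0// (le_trans B0).
have h3 : 0 <= p * B * a * (b - a / 2).
  by rewrite !mulr_ge0 ?(ltW p0) ?(ltW a0)//; lra.
nra.
Qed.

(** The smoothness inequality of the [p]-th power of the Euclidean norm: its
    middle term is linear in [v], so it disappears when [v] is integrated with
    mean zero. *)
Lemma powR_enormD u v p : 1 < p <= 2 ->
  enorm (u + v) `^ p <=
    enorm u `^ p + p * enorm u `^ (p - 2) * dot u v + 2 * enorm v `^ p.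
Proof.
move=> p12; rewrite (powR_enorm (u + v)) sqr_enormD.
apply: powR_sqr_add; rewrite ?enorm_ge0//.
  by rewrite ler_norml cauchy_schwarzN cauchy_schwarz.
by rewrite -sqr_enormD sqr_ge0.
Qed.

Lemma powR_enorm_contraction u v (p t : R) : 1 <= p -> 0 < t <= 1 ->
  enorm ((1 - t) *: (u + v)) `^ p
    <= (1 - t) * enorm u `^ p + t `^ (1 - p) * enorm v `^ p.
Proof.
move=> p1 t01; have /andP[t0 t1] := t01.
apply: le_trans (powR_contraction (enorm_ge0 u) (enorm_ge0 v) p1 t01).
rewrite enormZ ger0_norm ?subr_ge0//.
rewrite ge0_ler_powR ?nnegrE ?mulr_ge0 ?subr_ge0 ?addr_ge0 ?enorm_ge0//.
  exact: le_trans p1.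
by rewrite ler_wpM2l ?subr_ge0 ?enorm_triangle.
Qed.

End euclidean.

(** * Descent along a normalized step *)

Section smooth_descent.
Context {R : realType} {n : nat}.
Variables (f : 'rV[R]_n -> R) (L : R).
Hypothesis df : forall x, differentiable f x.
Hypothesis L0 : 0 <= L.
Hypothesis lip : forall x y, enorm (grad f x - grad f y) <= L * enorm (x - y).
Implicit Types x h m : 'rV[R]_n.

Lemma diff_grad x h : 'd f x h = dot (grad f x) h.
Proof.
rewrite {1}(row_sum_delta h) raddf_sum; apply: eq_bigr => i _.
by rewrite [LHS]linearZ/= mxE deriveE// mulrC.
Qed.

Lemma is_derive_line x h (t : R) :
  is_derive t (1 : R) (fun s : R => f (x + s *: h)) (dot (grad f (x + t *: h)) h).
Proof.
have dg : is_diff t (cst x + (fun s : R => s *: h)) (0 + ( *:%R ^~ h)).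
  exact: is_diffD.
have dgt : differentiable (cst x + (fun s : R => s *: h)) t by [].
have dfx := df (x + t *: h).
have dfg : differentiable (f \o (cst x + (fun s : R => s *: h))) t.
  exact: differentiable_comp.
apply: DeriveDef; first exact: diff_derivable.
transitivity ('D_1 (f \o (cst x + (fun s : R => s *: h))) t); first by [].
rewrite (deriveE _ dfg) diff_comp//=.
by rewrite diff_val/= add0r scale1r diff_grad.
Qed.

(** The mean value theorem instead of an integral of the gradient: it gives [L]
    in place of [L / 2], which the constant [M1] has room for. *)
Lemma smooth_upper_bound x h :
  f (x + h) <= f x + dot (grad f x) h + L * enorm h ^+ 2.
Proof.
have cf : {within `[0, 1]%classic, continuous (fun s : R => f (x + s *: h))}.
  apply: continuous_subspaceT => t.
  have [d _] := is_derive_line x h t.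
  by apply: differentiable_continuous; apply/derivable1_diffP.
have [c] := @MVT R _ _ 0 1 ltr01 (fun t _ => is_derive_line x h t) cf.
rewrite in_itv/= => /andP[c0 c1].
rewrite scale1r scale0r addr0 subr0 mulr1 => E.
have -> : f (x + h) = f x + dot (grad f (x + c *: h)) h by rewrite -E; ring.
rewrite -addrA lerD2l.
have -> : dot (grad f (x + c *: h)) h =
    dot (grad f x) h + dot (grad f (x + c *: h) - grad f x) h.
  by rewrite dotDl dotNl; ring.
rewrite lerD2l (le_trans (cauchy_schwarz _ _))//.
rewrite expr2 mulrA ler_wpM2r ?enorm_ge0// (le_trans (lip _ _))//.
rewrite addrC addKr enormZ ger0_norm ?(ltW c0)// ler_wpM2l//.
by rewrite ler_piMl ?enorm_ge0// ltW.
Qed.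

Lemma normalized_step_descent x m (eta : R) : 0 <= eta ->
  eta * enorm (grad f x) <= f x - f (x - (eta / enorm m) *: m)
    + 2 * eta * enorm (m - grad f x) + L * eta ^+ 2.
Proof.
move=> eta0; set g := grad f x; set e := enorm (m - g).
have ge : enorm g <= enorm m + e.
  have := enorm_triangle m (g - m); rewrite subrKC -(enormN (g - m)) opprB.
  exact.
(* With division by zero equal to zero, the step is zero when [m = 0]. *)
have [m0|m0] := eqVneq (enorm m) 0.
  rewrite m0 invr0 mulr0 scale0r subr0 subrr add0r.
  rewrite m0 add0r in ge.
  have : 0 <= L * eta ^+ 2 by rewrite mulr_ge0 ?sqr_ge0.
  have := enorm_ge0 (m - g); rewrite -/e; nra.
have {}m0 : 0 < enorm m by rewrite lt0r m0 enorm_ge0.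
have := smooth_upper_bound x (- ((eta / enorm m) *: m)).
rewrite dotNr dotZr enormN enormZ ger0_norm ?divr_ge0 ?enorm_ge0//.
rewrite divfK ?gt_eqF// -/g.
have : eta * (enorm m - e) <= eta / enorm m * dot g m.
  rewrite -mulrA ler_wpM2l// mulrC ler_pdivlMr//.
  have := cauchy_schwarz (m - g) m.
  by rewrite dotDl dotNl -sqr_enorm -/e; nra.
nra.
Qed.

End smooth_descent.

(** * Borel measurability of vector-valued maps *)

Section borel_rV_measurability.
Context {R : realType} {n : nat}.

Lemma continuous_measurable_rV (g : 'rV[R]_n -> R) :
  continuous g -> measurable_fun [set: borel_rV R n] g.
Proof.
move=> /continuousP cg; apply: (measurability _ (RGenOpens.measurableE R)).
move=> _ [_ [a [b ->] <-]]; rewrite setTI.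
by apply: sub_sigma_algebra; apply: cg; exact: interval_open.
Qed.

Lemma measurable_coord d (S : measurableType d) (h : S -> borel_rV R n) i :
  measurable_fun setT h -> measurable_fun setT (fun s => h s 0 i).
Proof.
move=> mh; have := continuous_measurable_rV (@coord_continuous R 1 n 0 i).
by move=> /measurableT_comp/(_ mh).
Qed.

(** Every open set is a countable union of cubes with rational centers and radii
    [1 / (k + 1)], so the coordinates generate the Borel sigma-algebra. *)
Lemma measurable_rVP d (S : measurableType d) (h : S -> borel_rV R n) :
  (forall i, measurable_fun setT (fun s => h s 0 i)) -> measurable_fun setT h.
Proof.
move=> mh; apply: (@measurability _ _ S (borel_rV R n) setT h (@open 'rV[R]_n)) => //.
move=> _ [U oU <-]; rewrite setTI.
pose B (q : 'rV[rat]_n * nat) : set 'rV[R]_n :=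
  [set v | forall i, `|ratr (q.1 0 i) - v 0 i| < q.2.+1%:R^-1].
have BE q : B q = ball (map_mx ratr q.1 : 'rV[R]_n) (q.2.+1%:R^-1 : R).
  apply/seteqP; split => v /=.
    move=> Bv; split; first by rewrite invr_gt0 ltr0n.
    by move=> i j; rewrite ord1 mxE; exact: Bv.
  by case=> _ Bv i; have := Bv 0 i; rewrite mxE.
pose C q := if `[< B q `<=` U >] then B q else set0.
have -> : h @^-1` U = \bigcup_q (h @^-1` C q).
  apply/seteqP; split => s /=; last first.
    by case=> q _; rewrite /C /=; case: asboolP => // BU /BU.
  move=> Us; have /nbhs_ballP[e e0 eU] : nbhs (h s : 'rV[R]_n) U.
    exact: open_nbhs_nbhs.
  have [k ke] : exists k, (k.+1%:R^-1 : R) < e / 2.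
    have /ltr_add_invr[k] : 0 < e / 2 by rewrite divr_gt0.
    by rewrite add0r; exists k.
  have /choice[q qP] : forall i, exists q : rat,
      `|ratr q - (h s : 'rV[R]_n) 0 i| < (k.+1%:R^-1 : R).
    move=> i; set x := (h s : 'rV[R]_n) 0 i.
    have : x - k.+1%:R^-1 < x + k.+1%:R^-1.
      by rewrite ltrD2l gtrN// invr_gt0 ltr0n.
    move=> /rat_in_itvoo[q]; rewrite in_itv/= => /andP[q1 q2]; exists q.
    by rewrite ltr_distl q1 q2.
  exists (\row_i q i, k) => //; rewrite /C /=; case: asboolP => [_ i|].
    by rewrite mxE; exact: qP.
  case; rewrite BE => v [_ qv]; apply: eU; split=> // i j; rewrite ord1 /ball/=.
  have := qv 0 j; rewrite !mxE/= /ball/= => qvj.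
  have := ler_distD (ratr (q j)) ((h s : 'rV[R]_n) 0 j) (v 0 j).
  move=> /le_lt_trans; apply.
  rewrite [ltRHS]splitr; apply: ltrD; apply: lt_trans ke => //; rewrite distrC; exact: qP.
apply: countable_bigcupT_measurable => // q.
rewrite /C; case: asboolP => [_|_]; last by rewrite preimage_set0.
have -> : h @^-1` (B q) = ~` \bigcup_(i in [set: 'I_n])
    ~` ((fun s => h s 0 i) @^-1` [set x | `|ratr (q.1 0 i) - x| < q.2.+1%:R^-1]).
  rewrite setC_bigcup; apply/seteqP; split => s /=.
    by move=> Bs i _; rewrite setCK; exact: Bs.
  by move=> Bs i; have := Bs i I; rewrite setCK.
apply: measurableC; apply: fin_bigcup_measurable => // i _; apply: measurableC.
rewrite -[X in measurable X]setTI; apply: mh => //.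
exact: measurable_ball.
Qed.

End borel_rV_measurability.

(** * Independence and iterated integrals *)

Section independence_lemmas.
Context d (T : measurableType d) (R : realType) (P : probability T R).

(** The joint law of [X] and [Y] agrees with the product of their laws on
    rectangles, hence everywhere; then Tonelli. Freezing [X w] in the inner
    integral plays the part of conditioning on [X]. *)
Lemma integral_independent d1 d2 (S1 : measurableType d1)
    (S2 : measurableType d2) (X : T -> S1) (Y : T -> S2) (F : S1 * S2 -> \bar R) :
  measurable_fun setT X -> measurable_fun setT Y ->
  (forall A B, measurable A -> measurable B ->
    P (X @^-1` A `&` Y @^-1` B) = P (X @^-1` A) * P (Y @^-1` B))%E ->
  measurable_fun setT F -> (forall z, 0 <= F z)%E ->
  (\int[P]_w F (X w, Y w) = \int[P]_w \int[P]_w' F (X w, Y w'))%E.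
Proof.
move=> mX mY XY mF F0.
have mXY : measurable_fun setT (fun w => (X w, Y w)) by exact: measurable_fun_pair.
pose X' : {mfun T >-> S1} := HB.pack X (isMeasurableFun.Build _ _ _ _ _ mX).
pose Y' : {mfun T >-> S2} := HB.pack Y (isMeasurableFun.Build _ _ _ _ _ mY).
pose XY' : {mfun T >-> (S1 * S2)%type} :=
  HB.pack (fun w => (X w, Y w)) (isMeasurableFun.Build _ _ _ _ _ mXY).
transitivity (\int[distribution P XY']_z F z)%E.
  by rewrite ge0_integral_distribution.
transitivity (\int[distribution P X' \x distribution P Y']_z F z)%E.
  apply: eq_measure_integral => A mA _; apply/esym.
  by apply: product_measure_unique => // B C mB mC; exact: XY.
rewrite fubini_tonelli1// ge0_integral_distribution//=.
- apply: eq_integral => w _; rewrite /fubini_F ge0_integral_distribution//.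
  exact: measurableT_comp.
- exact: measurable_fun_fubini_tonelli_F.
- by move=> y; apply: integral_ge0.
Qed.

Lemma measurable_integral_section d1 d2 (S1 : measurableType d1)
    (S2 : measurableType d2) (X : T -> S1) (Y : T -> S2) (F : S1 * S2 -> \bar R) :
  measurable_fun setT X -> measurable_fun setT Y ->
  measurable_fun setT F -> (forall z, 0 <= F z)%E ->
  measurable_fun setT (fun w => \int[P]_w' F (X w, Y w'))%E.
Proof.
move=> mX mY mF F0.
pose Y' : {mfun T >-> S2} := HB.pack Y (isMeasurableFun.Build _ _ _ _ _ mY).
have mF' := measurable_fun_fubini_tonelli_F (m2 := distribution P Y') F mF F0.
apply: eq_measurable_fun (measurableT_comp mF' mX) => w _.
rewrite /= /fubini_F ge0_integral_distribution//.
exact: measurableT_comp.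
Qed.

Lemma same_law_integral d' (S : measurableType d') (X Y : {RV P >-> S})
    (F : S -> \bar R) :
  same_law X Y -> measurable_fun setT F -> (forall z, 0 <= F z)%E ->
  (\int[P]_w F (X w) = \int[P]_w F (Y w))%E.
Proof.
move=> XY mF F0.
rewrite -(ge0_integral_distribution X mF F0) -(ge0_integral_distribution Y mF F0).
by apply: eq_measure_integral => A mA _; exact: XY.
Qed.

(** A generating family for the information in [X 0], ..., [X (k - 1)]. *)
Definition sigma_past d' (S : measurableType d') (X : nat -> T -> S) (k : nat) :
    set_system T :=
  \bigcup_(j in [set j | (j < k)%N]) sigma_rv (X j).

(** Mutual independence speaks of finite intersections only. The cylinders they
    form are a pi-system that generates the past, and the events satisfying the
    product rule form a lambda-system. *)
Lemma independent_past d' (S : measurableType d') (X : nat -> {RV P >-> S}) k A B :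
  mutually_independent P (fun k => sigma_rv (X k)) ->
  measurable A -> <<s sigma_past (fun j => X j : T -> S) k >> B ->
  (P (B `&` X k @^-1` A) = P B * P (X k @^-1` A))%E.
Proof.
move=> Xind mA.
pose cyl (E : nat -> set S) := \bigcap_(j in [set j | (j < k)%N]) (X j @^-1` E j).
pose Pi := [set C | exists2 E, (forall j, measurable (E j)) & C = cyl E].
have mX j E : measurable E -> measurable (X j @^-1` E).
  by move=> mE; rewrite -[X in measurable X]setTI; exact: measurable_funP.
have mcyl E : (forall j, measurable (E j)) -> measurable (cyl E).
  by move=> mE; apply: bigcap_measurableType => j _; exact: mX.
pose J : {fset nat} := [fset j in iota 0 k]%fset.
have JE j : (j \in J) = (j < k)%N by rewrite in_fset/= mem_iota.
have kJ : k \notin J by rewrite JE ltnn.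
have setJ : [set` J] = [set j | (j < k)%N].
  by apply/seteqP; split => j /=; rewrite JE.
have Pcyl E : (forall j, measurable (E j)) ->
    P (cyl E) = (\prod_(j <- J) P (X j @^-1` E j))%E.
  move=> mE; rewrite -Xind; first by rewrite setJ.
  by move=> j _; exists (E j) => //; rewrite setTI.
have Pcyl_indep E : (forall j, measurable (E j)) ->
    (P (cyl E `&` X k @^-1` A) = P (cyl E) * P (X k @^-1` A))%E.
  move=> mE; pose E' j := if j == k then A else E j.
  have mE' j : measurable (E' j) by rewrite /E'; case: ifP.
  have -> : cyl E `&` X k @^-1` A =
      \bigcap_(j in [set` (k |` J)%fset]) (X j @^-1` E' j).
    apply/seteqP; split => [w [cw Aw] j/=|w cw].
      rewrite in_fset1U /E' => /orP[/eqP->|]; first by rewrite eqxx.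
      by rewrite JE => jk; rewrite (ltn_eqF jk); exact: cw.
    split=> [j jk|]; last first.
      by have := cw k; rewrite /= in_fset1U eqxx /E' eqxx; exact.
    by have := cw j; rewrite /= in_fset1U JE jk orbT /E' (ltn_eqF jk); exact.
  rewrite Xind; last by move=> j _; exists (E' j) => //; rewrite setTI.
  rewrite big_fsetU1//= {1}/E' eqxx muleC (Pcyl _ mE); congr (_ * _)%E.
  apply: eq_big_seq => j; rewrite JE => jk.
  by rewrite /E' (ltn_eqF jk).
suff : <<s Pi >> `<=` [set B | measurable B /\
    (P (B `&` X k @^-1` A) = P B * P (X k @^-1` A))%E].
  move=> sub pB; have [] // := sub B _; apply: smallest_sub pB.
    exact: smallest_sigma_algebra.
  move=> C [j jk [E mE <-]]; apply: sub_sigma_algebra.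
  exists (fun i => if i == j then E else setT).
    by move=> i; case: ifP.
  rewrite setTI; apply/seteqP; split => [w Ew i ik/=|w Cw].
    by case: ifPn => // /eqP ->.
  by have := Cw j jk; rewrite /= eqxx.
apply: lambda_system_subset; last by [].
- move=> _ _ [E mE ->] [E' mE' ->]; exists (fun j => E j `&` E' j).
    by move=> j; exact: measurableI.
  apply/seteqP; split => [w [c c'] j jk|w c]; first by split; [exact: c|exact: c'].
  by split=> j jk; have [] := c j jk.
- apply/dynkin_lambda_system; split.
  + by split => //; rewrite setTI probability_setT mul1e.
  + move=> B' [mB' PB']; split; first exact: measurableC.
    have mXA := mX k A mA.
    rewrite probability_setC//.
    have -> : ~` B' `&` X k @^-1` A = X k @^-1` A `\` (B' `&` X k @^-1` A).
      by apply/seteqP; split => w /=; tauto.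
    rewrite measureD//; last 2 first.
      exact: measurableI.
      by rewrite (le_lt_trans (probability_le1 _ _))// ltry.
    rewrite [X k @^-1` A `&` _]setICA setIid [X in (_ - X)%E]PB' muleBl ?mul1e//.
    exact: fin_num_measure.
  + move=> F tF HF.
    have mF j : measurable (F j) by have [] := HF j.
    have PF j : P (F j `&` X k @^-1` A) = (P (F j) * P (X k @^-1` A))%E.
      by have [] := HF j.
    split; first exact: bigcupT_measurable.
    rewrite setI_bigcupl.
    rewrite measure_semi_bigcup//; last 3 first.
      by move=> j; apply: measurableI => //; exact: mX.
      by apply: trivIset_setIr.
      apply: bigcupT_measurable => j; apply: measurableI => //; exact: mX.
    rewrite measure_semi_bigcup//; last exact: bigcupT_measurable.
    have PA : P (X k @^-1` A) \is a fin_num.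
      by rewrite fin_num_measure//; exact: mX.
    rewrite muleC -(fineK PA) -nneseriesZl//.
    by apply: eq_eseriesr => j _; rewrite fineK// [RHS]muleC; exact: PF.
- by move=> _ [E mE ->]; split; [exact: mcyl|exact: Pcyl_indep].
Qed.

End independence_lemmas.

(** * Measurability of the iteration *)

Section process_measurability.
Context {R : realType} {n : nat}.

Lemma measurable_enorm : measurable_fun [set: borel_rV R n] (@enorm R n).
Proof.
have ms : measurable_fun [set: borel_rV R n]
    (fun v : borel_rV R n => \sum_(i < n) (v : 'rV[R]_n) 0 i ^+ 2).
  apply: measurable_sum => i; apply: measurable_funX.
  exact: continuous_measurable_rV (@coord_continuous R 1 n 0 i).
exact: (measurableT_comp (continuous_measurable_fun (@sqrt_continuous R)) ms).
Qed.

Lemma measurable_lincomb d (S : measurableType d) (c1 c2 : S -> R)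
    (h1 h2 : S -> borel_rV R n) :
  measurable_fun setT c1 -> measurable_fun setT c2 ->
  measurable_fun setT h1 -> measurable_fun setT h2 ->
  measurable_fun setT
    (fun s => (c1 s *: (h1 s : 'rV[R]_n) + c2 s *: (h2 s : 'rV[R]_n)) : borel_rV R n).
Proof.
move=> mc1 mc2 mh1 mh2; apply: measurable_rVP => i.
under eq_fun do rewrite !mxE.
by apply: measurable_funD; apply: measurable_funM => //; exact: measurable_coord.
Qed.

Context d' (Xi : measurableType d').
Variable G : 'rV[R]_n -> Xi -> 'rV[R]_n.
Hypothesis G_meas : measurable_fun [set: borel_rV R n * Xi]
  (fun p : borel_rV R n * Xi => (G p.1 p.2 : borel_rV R n)).
Variables (x0 : 'rV[R]_n) (eta theta : nat -> R).

Lemma measurable_gradient_estimate d (S : measurableType d)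
    (x : S -> borel_rV R n) (z : S -> Xi) :
  measurable_fun setT x -> measurable_fun setT z ->
  measurable_fun setT (fun s => G (x s) (z s) : borel_rV R n).
Proof.
move=> mx mz; exact: (measurableT_comp G_meas (measurable_fun_pair mx mz)).
Qed.

Lemma measurable_momentum d (S : measurableType d) (xs : nat -> S -> Xi) k
    (x m : S -> borel_rV R n) :
  measurable_fun setT (xs k) -> measurable_fun setT x -> measurable_fun setT m ->
  measurable_fun setT
    (fun s => (momentum G theta (xs^~ s) k (x s) (m s) : borel_rV R n)).
Proof.
move=> mxs mx mm; apply: measurable_lincomb => //.
exact: measurable_gradient_estimate.
Qed.

Lemma measurable_sfom_state d (S : measurableType d) (xs : nat -> S -> Xi) k :
  (forall j, (j < k)%N -> measurable_fun setT (xs j)) ->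
  measurable_fun setT (fun s =>
    sfom_state G x0 eta theta (xs^~ s) k : borel_rV R n * borel_rV R n).
Proof.
elim: k => [_|k IH mxs]; first exact: measurable_cst.
have /measurable_fun_pairP[mx mm] := IH (fun j jk => mxs j (ltnW jk)).
have mm' := measurable_momentum (mxs k (ltnSn k)) mx mm.
set m' := (X in measurable_fun _ X) in mm'.
set x := (X in measurable_fun _ X) in mx.
have -> : (fun s => sfom_state G x0 eta theta (xs^~ s) k.+1) =
    (fun s => (1 *: (x s : 'rV[R]_n) + (- (eta k / enorm (m' s))) *: (m' s : 'rV[R]_n),
               m' s)).
  apply/funext => s /=; rewrite /m' /x /=.
  by case: (sfom_state _ _ _ _ _ _) => a b; rewrite scale1r scaleNr.
apply: measurable_fun_pair => //; apply: measurable_lincomb => //.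
apply: measurableT_comp => //; apply: measurable_funM => //.
(* The norm is nonnegative, so its inverse is its power [-1]. *)
under eq_fun do rewrite -(powR_inv1 (enorm_ge0 _)).
apply: measurableT_comp (measurable_powR _) _.
exact: measurableT_comp measurable_enorm mm'.
Qed.

(** The state before step [k] depends on the first [k] samples only: apply
    [measurable_sfom_state] on the same sample space with the sigma-algebra they
    generate. *)
Lemma measurable_sfom_state_past d (T : measurableType d)
    (xs : nat -> T -> Xi) k (B : set (borel_rV R n * borel_rV R n)) :
  measurable B ->
  <<s sigma_past xs k >> ((fun w => sfom_state G x0 eta theta (xs^~ w) k) @^-1` B).
Proof.
move=> mB; pose S := g_sigma_algebraType (sigma_past xs k).
have := @measurable_sfom_state _ S xs k.
have mxs j : (j < k)%N -> measurable_fun [set: S] (xs j : S -> Xi).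
  move=> jk _ A mA; rewrite setTI; apply: sub_sigma_algebra.
  by exists j => //; exists A => //; rewrite setTI.
by move=> /(_ mxs measurableT B mB); rewrite setTI.
Qed.

End process_measurability.

(** * One step of the momentum error in mean *)

Section noise_step.
Context {R : realType} {n : nat} d (T : measurableType d) (P : probability T R).

Lemma mean_powR_centered (u : 'rV[R]_n) (V : T -> borel_rV R n) (p s : R) :
  1 < p <= 2 -> measurable_fun setT V ->
  (forall i, P.-integrable setT (fun w => ((V w : 'rV[R]_n) 0 i)%:E)) ->
  (forall i, \int[P]_w ((V w : 'rV[R]_n) 0 i)%:E = 0)%E ->
  (\int[P]_w (enorm (V w : 'rV[R]_n) `^ p)%:E <= s%:E)%E ->
  (\int[P]_w (enorm (u + (V w : 'rV[R]_n)) `^ p)%:E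
     <= (enorm u `^ p + 2 * s)%:E)%E.
Proof.
move=> p12 mV iV V0 Vp.
have mpow (h : T -> borel_rV R n) : measurable_fun setT h ->
    measurable_fun setT (fun w => (enorm (h w : 'rV[R]_n) `^ p)%:E).
  move=> mh; apply/measurable_EFinP; apply: measurableT_comp (measurable_powR _) _.
  exact: measurableT_comp measurable_enorm mh.
have muV : measurable_fun setT (fun w => (u + (V w : 'rV[R]_n)) : borel_rV R n).
  have -> : (fun w => (u + (V w : 'rV[R]_n)) : borel_rV R n) =
      (fun w => 1 *: u + 1 *: (V w : 'rV[R]_n)).
    by apply/funext => w; rewrite !scale1r.
  exact: measurable_lincomb.
pose c := p * enorm u `^ (p - 2).
have iVp : P.-integrable setT (fun w => (enorm (V w : 'rV[R]_n) `^ p)%:E).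
  apply/integrableP; split; first exact: mpow.
  apply: le_lt_trans (ltry s); apply: le_trans Vp; rewrite le_eqVlt.
  apply/orP; left; apply/eqP; apply: eq_integral => w _.
  by rewrite gee0_abs// lee_fin powR_ge0.
have idot : P.-integrable setT
    (fun w => \sum_(i < n) (c * u 0 i)%:E * ((V w : 'rV[R]_n) 0 i)%:E)%E.
  by apply: integrable_sum => // i _; exact: integrableZl.
have icst : P.-integrable setT (EFin \o cst (enorm u `^ p)).
  exact: finite_measure_integrable_cst.
have i2 : P.-integrable setT (fun w => 2%:E * (enorm (V w : 'rV[R]_n) `^ p)%:E)%E.
  exact: integrableZl.
have dotE w : (\sum_(i < n) (c * u 0 i)%:E * ((V w : 'rV[R]_n) 0 i)%:E =
    (c * dot u (V w))%:E)%E.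
  rewrite sumEFin mulr_sumr; congr EFin; apply: eq_bigr => i _.
  by rewrite mulrA.
apply: (@le_trans _ _ (\int[P]_w ((enorm u `^ p)%:E +
  (\sum_(i < n) (c * u 0 i)%:E * ((V w : 'rV[R]_n) 0 i)%:E) +
  2%:E * (enorm (V w : 'rV[R]_n) `^ p)%:E))%E).
  have key w : ((enorm (u + (V w : 'rV[R]_n)) `^ p)%:E <= (enorm u `^ p)%:E +
      (\sum_(i < n) (c * u 0 i)%:E * ((V w : 'rV[R]_n) 0 i)%:E) +
      2%:E * (enorm (V w : 'rV[R]_n) `^ p)%:E)%E.
    by rewrite dotE -EFinM -!EFinD lee_fin; exact: powR_enormD.
  apply: ge0_le_integral => //.
  - by move=> w _; rewrite lee_fin powR_ge0.
  - exact: mpow.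
  - apply: (@measurable_int _ _ _ P).
    exact: integrableD (integrableD measurableT icst idot) i2.
rewrite integralD//; last exact: (integrableD measurableT icst idot).
rewrite integralD//= integral_sum//; last by move=> i; exact: integrableZl.
rewrite big1 ?adde0; last by move=> i _; rewrite integralZl// V0 mule0.
rewrite integralZl// integral_cst//= probability_setT mule1.
by rewrite [leRHS]EFinD leeD2l// [leRHS]EFinM lee_pmul2l ?lte_fin.
Qed.

Context d' (Xi : measurableType d').
Variables (G : 'rV[R]_n -> Xi -> 'rV[R]_n) (gf : 'rV[R]_n -> 'rV[R]_n).
Variables (xi : {RV P >-> Xi}) (xis : nat -> {RV P >-> Xi}).
Variables (x0 : 'rV[R]_n) (eta theta : nat -> R) (alpha sigma : R).
Hypothesis gf_cont : continuous gf.
Hypothesis G_meas : measurable_fun [set: borel_rV R n * Xi]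
  (fun p : borel_rV R n * Xi => (G p.1 p.2 : borel_rV R n)).
Hypothesis alpha12 : 1 < alpha <= 2.
Hypothesis G_int : forall x (i : 'I_n),
  P.-integrable setT (fun w => (G x (xi w) 0 i)%:E).
Hypothesis G_unbiased : forall x (i : 'I_n),
  (\int[P]_w (G x (xi w) 0%R i)%:E = (gf x 0%R i)%:E)%E.
Hypothesis G_moment : forall x,
  (\int[P]_w (enorm (G x (xi w) - gf x) `^ alpha)%:E <= (sigma `^ alpha)%:E)%E.
Hypothesis xis_law : forall k, same_law (xis k) xi.
Hypothesis xis_indep : mutually_independent P (fun k => sigma_rv (xis k)).
Hypothesis theta01 : forall k, 0 < theta k <= 1.

Let state k w := sfom_state G x0 eta theta (fun j => xis j w) k.

Lemma theta_prev01 k : 0 < theta_prev theta k <= 1.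
Proof. by case: k => [|k]//=; rewrite ltr01 lexx. Qed.

Lemma measurable_gf : measurable_fun [set: borel_rV R n]
  (fun x : borel_rV R n => (gf x : borel_rV R n)).
Proof.
apply: measurable_rVP => i.
have cg : continuous (fun x : 'rV[R]_n => gf x 0 i).
  move=> x; exact: (@continuous_comp _ _ _ gf (fun v : 'rV[R]_n => v 0 i) x
    (@gf_cont x) (@coord_continuous R 1 n 0 i (gf x))).
exact: (continuous_measurable_rV cg).
Qed.

Lemma measurable_G_section (x : 'rV[R]_n) :
  measurable_fun setT (fun w => G x (xi w) : borel_rV R n).
Proof. exact: measurable_gradient_estimate. Qed.

(** One step from a fixed state, for a fresh sample: [mean_powR_centered] with
    the deterministic part [u = (1 - t) (m - gf x)] and the noise
    [V = t (G x xi - gf x)]. *)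
Lemma mean_powR_momentum k (x m : 'rV[R]_n) :
  (\int[P]_w (enorm (((1 - theta_prev theta k) *: m
       + theta_prev theta k *: G x (xi w)) - gf x) `^ alpha)%:E
   <= (enorm ((1 - theta_prev theta k) *: (m - gf x)) `^ alpha
        + 2 * (theta_prev theta k `^ alpha * sigma `^ alpha))%:E)%E.
Proof.
set t := theta_prev theta k.
have /andP[t0 t1] : 0 < t <= 1 by exact: theta_prev01.
pose V w := t *: G x (xi w) + (- t) *: gf x.
have -> : (\int[P]_w (enorm (((1 - t) *: m + t *: G x (xi w)) - gf x) `^ alpha)%:E
    = \int[P]_w (enorm ((1 - t) *: (m - gf x) + V w) `^ alpha)%:E)%E.
  apply: eq_integral => w _; congr ((enorm _ `^ _)%:E).
  by apply/rowP => i; rewrite !mxE; ring.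
have iV i : P.-integrable setT (fun w => (V w 0 i)%:E).
  under eq_fun do rewrite !mxE EFinD EFinM.
  apply: integrableD => //; first exact: integrableZl.
  exact: finite_measure_integrable_cst.
apply: mean_powR_centered => //.
- apply: measurable_lincomb => //; exact: measurable_G_section.
- move=> i; under eq_integral do rewrite !mxE EFinD EFinM.
  rewrite integralD//; last 2 first.
    exact: integrableZl.
    exact: finite_measure_integrable_cst.
  rewrite integralZl// G_unbiased integral_cst//= probability_setT.
  by rewrite mule1 -EFinM -EFinD mulNr subrr.
- have -> : (\int[P]_w (enorm (V w) `^ alpha)%:E =
     \int[P]_w ((t `^ alpha)%:E * (enorm (G x (xi w) - gf x) `^ alpha)%:E))%E.
    apply: eq_integral => w _; rewrite -EFinM; congr EFin.
    have -> : V w = t *: (G x (xi w) - gf x) by rewrite scalerBr /V scaleNr.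
    by rewrite enormZ ger0_norm ?(ltW t0)// powRM ?enorm_ge0// ltW.
  rewrite ge0_integralZl//.
  + by rewrite EFinM lee_pmul2l// lte_fin powR_gt0.
  + apply/measurable_EFinP; apply: measurableT_comp (measurable_powR _) _.
    apply: measurableT_comp measurable_enorm _.
    have -> : (fun w => G x (xi w) - gf x : borel_rV R n) =
        (fun w => 1 *: G x (xi w) + (- 1) *: gf x).
      by apply/funext => w; rewrite scale1r scaleN1r.
    apply: measurable_lincomb => //; exact: measurable_G_section.
  + by move=> w _; rewrite lee_fin powR_ge0.
  + by rewrite lee_fin powR_ge0.
Qed.

Lemma state_indep k (A : set (borel_rV R n * borel_rV R n)) (B : set Xi) :
  measurable A -> measurable B ->
  (P (state k @^-1` A `&` xis k @^-1` B) = P (state k @^-1` A) * P (xis k @^-1` B))%E.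
Proof.
move=> mA mB; apply: independent_past => //.
exact: (@measurable_sfom_state_past _ _ _ _ _ G_meas _ _ _ _ _
  (fun j => xis j : T -> Xi)).
Qed.

Lemma measurable_state k :
  measurable_fun setT (state k : T -> borel_rV R n * borel_rV R n).
Proof.
by apply: (@measurable_sfom_state _ _ _ _ _ G_meas _ _ _ _ _
  (fun j => xis j : T -> Xi)).
Qed.

Let err k w := (state k.+1 w).2 - gf (state k w).1.

Lemma stateS2 k w : (state k.+1 w).2 =
  momentum G theta (fun j => xis j w) k (state k w).1 (state k w).2.
Proof. by rewrite /state/=; case: (sfom_state _ _ _ _ _ _). Qed.

Lemma measurable_err k : measurable_fun setT (err k : T -> borel_rV R n).
Proof.
have /measurable_fun_pairP[mx _] := measurable_state k.
have /measurable_fun_pairP[_ mm] := measurable_state k.+1.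
have -> : err k = (fun w => 1 *: (state k.+1 w).2 + (- 1) *: gf (state k w).1).
  by apply/funext => w; rewrite /err scale1r scaleN1r.
by apply: measurable_lincomb => //; exact: (measurableT_comp measurable_gf mx).
Qed.

(** The state before step [k] is independent of the [k]-th sample, so
    [integral_independent] reduces the mean to [mean_powR_momentum]. Indexing by
    [theta_prev] covers the first step as well: there [t = 1] and the
    deterministic part vanishes. *)
Lemma mean_powR_err k :
  (\int[P]_w (enorm (err k w) `^ alpha)%:E <=
   \int[P]_w (enorm ((1 - theta_prev theta k) *:
                 ((state k w).2 - gf (state k w).1)) `^ alpha
              + 2 * (theta_prev theta k `^ alpha * sigma `^ alpha))%:E)%E.
Proof.
set t := theta_prev theta k.
pose F (z : (borel_rV R n * borel_rV R n) * Xi) : \bar R :=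
  (enorm (((1 - t) *: (z.1.2 : 'rV[R]_n) + t *: G z.1.1 z.2) - gf z.1.1)
     `^ alpha)%:E.
have m11 : measurable_fun setT (fun z : (borel_rV R n * borel_rV R n) * Xi => z.1.1).
  exact: (measurableT_comp measurable_fst measurable_fst).
have m12 : measurable_fun setT (fun z : (borel_rV R n * borel_rV R n) * Xi => z.1.2).
  exact: (measurableT_comp measurable_snd measurable_fst).
have mF : measurable_fun setT F.
  apply/measurable_EFinP; apply: measurableT_comp (measurable_powR _) _.
  apply: measurableT_comp measurable_enorm _.
  have mm : measurable_fun setT (fun z : (borel_rV R n * borel_rV R n) * Xi =>
      ((1 - t) *: (z.1.2 : 'rV[R]_n) + t *: G z.1.1 z.2 : borel_rV R n)).
    apply: measurable_lincomb => //.
    exact: measurable_gradient_estimate.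
  set g := (X in measurable_fun _ X).
  have -> : g = (fun z => 1 *: ((1 - t) *: (z.1.2 : 'rV[R]_n) + t *: G z.1.1 z.2)
      + (- 1) *: gf z.1.1).
    by apply/funext => w; rewrite /g scale1r scaleN1r.
  by apply: measurable_lincomb => //; exact: (measurableT_comp measurable_gf m11).
have F0 z : (0 <= F z)%E by rewrite lee_fin powR_ge0.
have -> : (\int[P]_w (enorm (err k w) `^ alpha)%:E
    = \int[P]_w F (state k w, xis k w))%E.
  by apply: eq_integral => w _; rewrite /F /err stateS2.
have mxis : measurable_fun setT (xis k) by [].
have mS := measurable_state k.
have E := integral_independent mS mxis (@state_indep k) mF F0.
rewrite E.
apply: ge0_le_integral => //.
- by move=> w _; apply: integral_ge0.
- exact: (measurable_integral_section P mS mxis mF F0).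
- have /measurable_fun_pairP[mx mm] := measurable_state k.
  apply/measurable_EFinP; apply: measurable_funD => //.
  apply: measurableT_comp (measurable_powR _) _.
  apply: measurableT_comp measurable_enorm _.
  set g := (X in measurable_fun _ X).
  have -> : g = (fun w => (1 - t) *: (state k w).2 + (- (1 - t)) *: gf (state k w).1).
    by apply/funext => w; rewrite /g scalerBr scaleNr.
  by apply: measurable_lincomb => //; exact: (measurableT_comp measurable_gf mx).
(* Only the law of the sample matters once the state is frozen. *)
move=> w _; case: (state k w) => x m /=.
pose h z := F ((x, m), z).
have mh : measurable_fun setT h.
  by exact: (measurableT_comp mF
    (@pair1_measurable _ _ (borel_rV R n * borel_rV R n)%type Xi (x, m))).
have hE : (\int[P]_w' h (xis k w') = \int[P]_w' h (xi w'))%E.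
  by apply: same_law_integral => // z; exact: F0.
rewrite -[X in (X <= _)%E]/(\int[P]_w' h (xis k w'))%E hE.
exact: mean_powR_momentum.
Qed.

End noise_step.

(** * Exponents of the step sizes and weights *)

Section step_size_exponents.
Context {R : realType}.
Variable alpha : R.
Hypothesis alpha12 : 1 < alpha <= 2.

Let alpha_gt1 : 1 < alpha. Proof. by case/andP: alpha12. Qed.

Let D_gt0 : 0 < 3 * alpha - 2.
Proof. by have := alpha_gt1; lra. Qed.

(** The exponent is the common solution of the three balance equations
    [weight_drift], [weight_noise] and [weight_young]. *)
Definition weight_ (k : nat) : R :=
  k.+1%:R `^ (- ((alpha - 1) * (2 - alpha) / (3 * alpha - 2))).

Let u_gt0 (k : nat) : 0 < k.+1%:R :> R. Proof. by rewrite ltr0n. Qed.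

Let powD (k : nat) (a b : R) : k.+1%:R `^ a * k.+1%:R `^ b = k.+1%:R `^ (a + b) :> R.
Proof. by rewrite powRD// (gt_eqF (u_gt0 k)) implybT. Qed.

Let powN1 (k : nat) (a : R) : a = -1 -> k.+1%:R `^ a = k.+1%:R^-1 :> R.
Proof. by move=> ->; rewrite powR_inv1. Qed.

Lemma eta_E k : eta_ alpha k = k.+1%:R `^ (- ((2 * alpha - 1) / (3 * alpha - 2))).
Proof. by rewrite /eta_ powRN div1r. Qed.

Lemma theta_E k : theta_ alpha k = k.+1%:R `^ (- (alpha / (3 * alpha - 2))).
Proof. by rewrite /theta_ powRN div1r. Qed.

Lemma eta_gt0 k : 0 < eta_ alpha k.
Proof. by rewrite eta_E powR_gt0. Qed.

Lemma theta_gt0 k : 0 < theta_ alpha k.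
Proof. by rewrite theta_E powR_gt0. Qed.

Lemma weight_gt0 k : 0 < weight_ k.
Proof. by rewrite powR_gt0. Qed.

Lemma theta_le1 k : theta_ alpha k <= 1.
Proof.
rewrite theta_E -[leRHS](powRr0 (k.+1%:R : R)) ler_powR ?ler1n//.
by rewrite oppr_le0 divr_ge0 ?(ltW D_gt0)//; have := alpha_gt1; lra.
Qed.

Lemma weight0 : weight_ 0 = 1.
Proof. by rewrite /weight_ powR1. Qed.

(** [weighted_telescope] relies on this; it holds because [alpha <= 2]. *)
Lemma weight_noninc k : weight_ k.+1 <= weight_ k.
Proof.
rewrite /weight_ !powRN lef_pV2 ?posrE ?powR_gt0//.
rewrite ge0_ler_powR ?nnegrE ?ler_nat//.
by rewrite divr_ge0 ?(ltW D_gt0)// mulr_ge0//; have := alpha12; lra.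
Qed.

Lemma weight_drift k :
  weight_ k * (theta_ alpha k `^ (1 - alpha) * eta_ alpha k `^ alpha) = k.+1%:R^-1.
Proof.
rewrite /weight_ eta_E theta_E -!powRrM !powD; apply: powN1.
by field; rewrite gt_eqF.
Qed.

Lemma weight_noise k : weight_ k * theta_ alpha k `^ alpha = k.+1%:R^-1.
Proof.
rewrite /weight_ theta_E -!powRrM !powD; apply: powN1.
by field; rewrite gt_eqF.
Qed.

Lemma weight_young k :
  eta_ alpha k `^ (alpha / (alpha - 1))
    * (weight_ k * theta_ alpha k) `^ (- (alpha - 1)^-1) = k.+1%:R^-1.
Proof.
rewrite /weight_ eta_E theta_E powD -!powRrM powD; apply: powN1.
by field; rewrite !gt_eqF// subr_gt0.
Qed.

Lemma sqr_eta_le k : eta_ alpha k ^+ 2 <= k.+1%:R^-1.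
Proof.
rewrite eta_E expr2 powD -(powR_inv1 (ltW (u_gt0 k))) ler_powR ?ler1n//.
rewrite -opprD lerN2 -mulrDl ler_pdivlMr// mul1r.
by have := alpha_gt1; lra.
Qed.

Lemma eta_ge k K : (k < K)%N ->
  K%:R `^ (- ((2 * alpha - 1) / (3 * alpha - 2))) <= eta_ alpha k.
Proof.
move=> kK; rewrite eta_E !powRN lef_pV2 ?posrE ?powR_gt0//; last first.
  by rewrite ltr0n (leq_ltn_trans _ kK).
rewrite ge0_ler_powR ?nnegrE ?ler_nat//.
by rewrite divr_ge0 ?(ltW D_gt0)//; have := alpha_gt1; lra.
Qed.

End step_size_exponents.

(** * From logarithmic decay to an iteration count *)

Section iteration_threshold.
Context {R : realType}.

Lemma ln_le_tangent (c x : R) : 0 < c -> 0 < x -> ln x <= ln c + x / c - 1.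
Proof.
move=> c0 x0; have xc : 0 < x / c by rewrite divr_gt0.
have := @le_ln1Dx R (x / c - 1); rewrite subrKC ln_div ?posrE//.
have h : -1 < x / c - 1 by lra.
by move=> /(_ h); move: (ln x) (ln c) (x / c) => a b e; lra.
Qed.

(** Equivalently [e <= 3]: the tangent bound gives [1 / 8 <= ln (8 / 7)], and
    [(8 / 7)^8 <= 3]. *)
Lemma ln_ge1 (x : R) : 3 <= x -> 1 <= ln x.
Proof.
move=> x3.
have : ln ((8 / 7) ^+ 8) <= ln x.
  by rewrite ler_ln ?posrE; [lra|lra|lra].
rewrite lnXn; last by lra.
have := @le_ln1Dx R (- 8^-1); have -> : 1 - 8^-1 = (8 / 7)^-1 :> R by field.
rewrite lnV ?posrE; last by lra.
have h : -1 < - 8^-1 :> R by lra.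
by move=> /(_ h); rewrite -mulr_natl; move: (ln _) (ln x) => a b; lra.
Qed.

(** Put [X = K^s]. If [c ln c <= X], the tangent of [ln] at [c] gives
    [ln X <= ln c + X / c - 1 <= 2 X / c], which is the claim because
    [ln X = s ln K] and [c = 2 M / (s eps)]. *)
Lemma log_threshold (M s eps : R) (K : nat) :
  0 < M -> 0 < s -> 0 < eps -> (0 < K)%N ->
  let c := 2 * M / (s * eps) in
  1 <= c -> (c * ln c) `^ s^-1 <= K%:R -> M * ln K%:R <= eps * K%:R `^ s.
Proof.
move=> M0 s0 e0 K0 c c1 cK.
have c0 : 0 < c by lra.
have K0' : 0 < K%:R :> R by rewrite ltr0n.
have clnc0 : 0 <= c * ln c by rewrite mulr_ge0 ?ln_ge0 ?(ltW c0).
have X0 : 0 < K%:R `^ s by rewrite powR_gt0.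
have cX : c * ln c <= K%:R `^ s.
  have := @ge0_ler_powR _ s (ltW s0) _ _ _ _ cK.
  rewrite !nnegrE powR_ge0 (ltW K0') -powRrM mulVf ?gt_eqF// powRr1//; exact.
have : ln (K%:R `^ s) <= 2 * (K%:R `^ s / c).
  apply: le_trans (ln_le_tangent c0 X0) _.
  have : ln c <= K%:R `^ s / c by rewrite ler_pdivlMr// mulrC.
  by move: (ln c) (_ / c) => a b; lra.
rewrite ln_powR /c => H.
have -> : M * ln K%:R = (M / s) * (s * ln K%:R) by field; rewrite gt_eqF.
have -> : eps * K%:R `^ s = (M / s) * (2 * (K%:R `^ s / (2 * M / (s * eps)))).
  by field; rewrite !gt_eqF.
by rewrite ler_pM2l// divr_gt0.
Qed.

End iteration_threshold.

(** * Sample-path estimates *)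

Section sample_path.
Context {R : realType} {n : nat} {Xi : Type}.
Variables (f : 'rV[R]_n -> R) (L flow : R).
Hypothesis df : forall x, differentiable f x.
Hypothesis L0 : 0 <= L.
Hypothesis lip : forall x y, enorm (grad f x - grad f y) <= L * enorm (x - y).
Hypothesis f_low : forall x, flow <= f x.
Variables (G : 'rV[R]_n -> Xi -> 'rV[R]_n) (x0 : 'rV[R]_n).
Variables (eta theta : nat -> R) (z : nat -> Xi).
Hypothesis eta0 : forall k, 0 <= eta k.
Hypothesis theta01 : forall k, 0 < theta k <= 1.

Let x := sfom_x G x0 eta theta z.
Let m := sfom_m G x0 eta theta z.
Let e k := m k - grad f (x k).

Lemma sfom_xS k : x k.+1 = x k - (eta k / enorm (m k)) *: m k.
Proof. by rewrite /x /m /sfom_x /sfom_m/=; case: (sfom_state _ _ _ _ _ _). Qed.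

Lemma sfom_step_le k : enorm (x k - x k.+1) <= eta k.
Proof.
rewrite sfom_xS opprB subrKC enormZ ger0_norm ?divr_ge0 ?enorm_ge0//.
have [->|m0] := eqVneq (enorm (m k)) 0; first by rewrite mulr0.
by rewrite divfK.
Qed.

(** Two consecutive gradients differ by at most [L eta_k], because a normalized
    step has length at most [eta_k]. *)
Lemma err_contraction (p : R) k : 1 <= p ->
  enorm ((1 - theta k) *: (m k - grad f (x k.+1))) `^ p
    <= (1 - theta k) * enorm (e k) `^ p
       + theta k `^ (1 - p) * (L `^ p * eta k `^ p).
Proof.
move=> p1.
have -> : m k - grad f (x k.+1) = e k + (grad f (x k) - grad f (x k.+1)).
  by rewrite /e subrKA.
apply: le_trans (powR_enorm_contraction _ _ p1 (theta01 k)) _.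
rewrite lerD2l ler_wpM2l ?powR_ge0// -powRM// ge0_ler_powR ?nnegrE ?mulr_ge0 ?enorm_ge0//.
  exact: le_trans p1.
by rewrite (le_trans (lip _ _))// ler_wpM2l// sfom_step_le.
Qed.

Lemma path_descent K :
  \sum_(k < K) eta k * enorm (grad f (x k))
    <= f x0 - flow + \sum_(k < K) (2 * eta k * enorm (e k) + L * eta k ^+ 2).
Proof.
suff H : \sum_(k < K) eta k * enorm (grad f (x k))
    <= f x0 - f (x K) + \sum_(k < K) (2 * eta k * enorm (e k) + L * eta k ^+ 2).
  by rewrite (le_trans H)// lerD2r lerD2l lerN2.
elim: K => [|K IH]; first by rewrite !big_ord0 addr0 subrr.
rewrite !big_ord_recr/=.
have := normalized_step_descent df L0 lip (x K) (m K) (eta0 K).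
by rewrite -sfom_xS -/(e K); lra.
Qed.

End sample_path.

(** Multiplying [a_{k+1} <= (1 - t_k) a_k + b_k] by a nonincreasing weight
    makes it telescope. *)
Lemma weighted_telescope {R : realType} (w t a b : nat -> R) K :
  (forall k, 0 <= w k) -> (forall k, w k.+1 <= w k) -> (forall k, 0 <= a k) ->
  (forall k, a k.+1 <= (1 - t k) * a k + b k) ->
  \sum_(k < K) w k * t k * a k <= w 0 * a 0 + \sum_(k < K) w k * b k.
Proof.
move=> w0 wS a0 aS.
suff : \sum_(k < K) w k * t k * a k + w K * a K
    <= w 0 * a 0 + \sum_(k < K) w k * b k.
  by have := mulr_ge0 (w0 K) (a0 K); lra.
elim: K => [|K IH]; first by rewrite !big_ord0 add0r addr0.
rewrite !big_ord_recr/=.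
have h1 : w K.+1 * a K.+1 <= w K * a K.+1 by rewrite ler_wpM2r.
have h2 : w K * a K.+1 <= w K * ((1 - t K) * a K + b K) by rewrite ler_wpM2l.
have h3 : w K * ((1 - t K) * a K + b K) = w K * a K - w K * t K * a K + w K * b K.
  by ring.
by lra.
Qed.

(** * A uniformly drawn index *)

Section uniform_index.
Context d (T : measurableType d) (R : realType) (P : probability T R).

Lemma uniform_below_out K (iota : {RV P >-> nat}) k :
  (0 < K)%N -> uniform_below K iota -> (K <= k)%N ->
  P (iota @^-1` [set k]) = 0%E.
Proof.
move=> K0 uK Kk.
pose D := \big[setU/set0]_(i < K) [set (i : nat)].
have PD : distribution P iota D = 1%E.
  rewrite (@measure_semi_additive_ord_I _ _ _ (distribution P iota) (fun i => [set i]))//.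
    rewrite (eq_bigr (fun=> (K%:R^-1)%:E)); last by move=> i _; exact: uK.
    rewrite sumEFin sumr_const card_ord -[X in X%:E]mulr_natr mulVf//.
    by rewrite pnatr_eq0 -lt0n.
  by move=> i j _ _ [_ [/= -> ->]].
have PC : distribution P iota (~` D) = 0%E.
  by rewrite probability_setC// [X in (_ - X)%E]PD subee.
apply/eqP; rewrite eq_le measure_ge0 andbT -PC.
apply: (@le_measure _ _ _ (distribution P iota)); rewrite ?inE//.
move=> _ /= ->; rewrite /D -(bigcup_mkord K (fun i => [set i])) => -[i /= iK ki].
by move: iK; rewrite -ki ltnNge Kk.
Qed.

(** Splitting along the countably many values of the index avoids any joint
    measurability of the process; values beyond [K] have probability zero, so
    their terms vanish even if the corresponding mean is infinite. *)
Lemma mean_uniform_index K (iota : {RV P >-> nat}) (g : nat -> T -> R) :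
  (0 < K)%N -> uniform_below K iota ->
  (forall k, measurable_fun setT (g k)) -> (forall k w, 0 <= g k w) ->
  (forall k A B, measurable B ->
    P (iota @^-1` A `&` g k @^-1` B) = P (iota @^-1` A) * P (g k @^-1` B))%E ->
  (\int[P]_w (g (iota w) w)%:E
    = (K%:R^-1)%:E * \int[P]_w (\sum_(k < K) g k w)%:E)%E.
Proof.
move=> K0 uK mg g0 ind.
pose h k w : \bar R := ((\1_[set k] (iota w) : R) * g k w)%:E.
have m1 k : measurable_fun setT (fun w => \1_[set k] (iota w) : R).
  have mi : measurable_fun setT (\1_[set k] : nat -> R) by [].
  exact: (measurableT_comp mi (measurable_funP iota)).
have mh k : measurable_fun setT (h k).
  by apply/measurable_EFinP; exact: measurable_funM.
have h0 k w : (0 <= h k w)%E by rewrite lee_fin mulr_ge0.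
have hE k : (\int[P]_w h k w = P (iota @^-1` [set k]) * \int[P]_w (g k w)%:E)%E.
  pose F (z : nat * R) : \bar R := ((\1_[set k] z.1 : R) * `|z.2|)%:E.
  have mi : measurable_fun setT (\1_[set k] : nat -> R) by [].
  have mF : measurable_fun setT F.
    apply/measurable_EFinP; apply: measurable_funM.
      exact: (measurableT_comp mi measurable_fst).
    exact: (measurableT_comp (@normr_measurable R setT) measurable_snd).
  have F0 z : (0 <= F z)%E by rewrite lee_fin mulr_ge0.
  have mio : measurable_fun setT (iota : T -> nat) by [].
  (* The absolute value makes [F] nonnegative everywhere and is invisible on the
     range of [g k]. *)
  have E := integral_independent mio (mg k) (fun A B _ => ind k A B) mF F0.
  transitivity (\int[P]_w F (iota w, g k w))%E.
    by apply: eq_integral => w _; rewrite /F /h/= ger0_norm.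
  rewrite E.
  transitivity (\int[P]_w ((\1_[set k] (iota w) : R)%:E * \int[P]_w' (g k w')%:E))%E.
    apply: eq_integral => w _; rewrite -ge0_integralZl//.
    - by apply: eq_integral => w' _; rewrite /F/= ger0_norm.
    - exact/measurable_EFinP.
    - by move=> w' _; rewrite lee_fin.
  rewrite ge0_integralZr//; last 2 first.
    exact/measurable_EFinP.
    by apply: integral_ge0 => w _; rewrite lee_fin.
  congr (_ * _)%E.
  transitivity (\int[P]_w (\1_(iota @^-1` [set k]) w)%:E)%E.
    apply: eq_integral => w _; rewrite !indicE.
    suff -> : (iota w \in [set k]) = (w \in iota @^-1` [set k]) by [].
    by apply/idP/idP => /set_mem ?; exact/mem_set.
  rewrite integral_indic ?setIT//.
  by rewrite -[X in measurable X]setTI; exact: measurable_funP.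
transitivity (\int[P]_w \sum_(k <oo) h k w)%E.
  apply: eq_integral => w _.
  rewrite (nneseries_split 0 (iota w).+1)//= add0n big_nat_recr//= eseries0 ?adde0.
    rewrite big1_seq ?add0e; first by rewrite /h indicE mem_set// mul1r.
    move=> i /=; rewrite mem_index_iota => /andP[_ iw].
    by rewrite /h indicE memNset ?mul0r//= => wi; rewrite wi ltnn in iw.
  move=> i /= iw _; rewrite /h indicE memNset ?mul0r//= => wi.
  by rewrite wi ltnn in iw.
rewrite integral_nneseries//.
rewrite (nneseries_split 0 K)//; last by move=> k _; apply: integral_ge0.
rewrite add0n eseries0 ?adde0; last first.
  by move=> k Kk _; rewrite hE (uniform_below_out K0 uK Kk) mul0e.
under [X in (_ = _ * X)%E]eq_integral do rewrite -sumEFin.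
rewrite ge0_integral_sum//; last 2 first.
  by move=> k; exact/measurable_EFinP.
  by move=> k w _; rewrite lee_fin.
rewrite ge0_sume_distrr; last first.
  by move=> k _; apply: integral_ge0 => w _; rewrite lee_fin.
rewrite big_mkord; apply: eq_bigr => k _; rewrite hE; congr (_ * _)%E.
exact: uK.
Qed.

End uniform_index.

(** * Mean estimates along the iteration *)

Section convergence.
Context {R : realType} {n : nat} d (T : measurableType d) (P : probability T R).
Context d' (Xi : measurableType d').
Variables (f : 'rV[R]_n -> R) (G : 'rV[R]_n -> Xi -> 'rV[R]_n).
Variables (xi : {RV P >-> Xi}) (xis : nat -> {RV P >-> Xi}).
Variables (x0 : 'rV[R]_n) (flow L1 sigma alpha : R).
Hypothesis f_C1 : cont_diff f.
Hypothesis G_meas : measurable_fun [set: borel_rV R n * Xi]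
  (fun p : borel_rV R n * Xi => (G p.1 p.2 : borel_rV R n)).
Hypothesis f_low : forall x, flow <= f x.
Hypothesis L1_gt0 : 0 < L1.
Hypothesis f_lip : forall x y, enorm (grad f x - grad f y) <= L1 * enorm (x - y).
Hypothesis alpha12 : 1 < alpha <= 2.
Hypothesis G_int : forall x (i : 'I_n),
  P.-integrable setT (fun w => (G x (xi w) 0 i)%:E).
Hypothesis G_unbiased : forall x (i : 'I_n),
  (\int[P]_w (G x (xi w) 0%R i)%:E = (grad f x 0%R i)%:E)%E.
Hypothesis G_moment : forall x,
  (\int[P]_w (enorm (G x (xi w) - grad f x) `^ alpha)%:E <= (sigma `^ alpha)%:E)%E.
Hypothesis xis_law : forall k, same_law (xis k) xi.
Hypothesis xis_indep : mutually_independent P (fun k => sigma_rv (xis k)).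

Local Notation eta := (eta_ alpha).
Local Notation theta := (theta_ alpha).

Let x k w := sfom_x G x0 eta theta (fun j => xis j w) k.
Let m k w := sfom_m G x0 eta theta (fun j => xis j w) k.
Let e k w := m k w - grad f (x k w).

Let theta01 k : 0 < theta k <= 1.
Proof. by rewrite theta_gt0 theta_le1. Qed.

Let alpha_gt0 : 0 < alpha. Proof. by move: alpha12; lra. Qed.

Let alpha_ge1 : 1 <= alpha. Proof. by move: alpha12; lra. Qed.

Let df y : differentiable f y. Proof. by case: f_C1. Qed.

Let gf_cont : continuous (grad f). Proof. by case: f_C1. Qed.

Let L1_ge0 : 0 <= L1. Proof. exact: ltW. Qed.

Definition mean_err k : \bar R := (\int[P]_w (enorm (e k w) `^ alpha)%:E)%E.

Lemma measurable_powR_err k :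
  measurable_fun setT (fun w => enorm (e k w) `^ alpha).
Proof.
apply: measurableT_comp (measurable_powR _) _.
apply: measurableT_comp measurable_enorm _.
exact: (measurable_err xis x0 eta theta gf_cont G_meas k).
Qed.

Lemma mean_err_ge0 k : (0 <= mean_err k)%E.
Proof. by apply: integral_ge0 => w _; rewrite lee_fin powR_ge0. Qed.

Let mean_powR_err' k :
  (mean_err k <=
   \int[P]_w (enorm ((1 - theta_prev theta k) *:
                 ((sfom_state G x0 eta theta (fun j => xis j w) k).2
                   - grad f (x k w))) `^ alpha
              + 2 * (theta_prev theta k `^ alpha * sigma `^ alpha))%:E)%E.
Proof.
exact: (mean_powR_err x0 eta gf_cont G_meas alpha12 G_int G_unbiased G_moment
  xis_law xis_indep theta01 k).
Qed.

Lemma mean_err0 : (mean_err 0 <= (2 * sigma `^ alpha)%:E)%E.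
Proof.
apply: le_trans (mean_powR_err' 0) _.
rewrite (eq_integral (cst (2 * sigma `^ alpha)%:E)); last first.
  move=> w _; rewrite /= subrr scale0r enorm0 powR0 ?gt_eqF// powR1 add0r.
  by rewrite mul1r.
by rewrite integral_cst//= probability_setT mule1.
Qed.

(** The recursion for the [alpha]-th moment of the momentum error: the noise is
    handled by [mean_powR_err], the drift of the gradient by
    [err_contraction]. *)
Lemma mean_errS_noise k : (mean_err k.+1 <= (1 - theta k)%:E * mean_err k
  + (theta k `^ (1 - alpha) * (L1 `^ alpha * eta k `^ alpha)
      + 2 * (theta k `^ alpha * sigma `^ alpha))%:E)%E.
Proof.
have /andP[t0 t1] := theta01 k.
apply: le_trans (mean_powR_err' k.+1) _.
rewrite -[theta_prev _ k.+1]/(theta k).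
set b := theta k `^ (1 - alpha) * _ ; set c := 2 * _.
have b0 : 0 <= b by rewrite !mulr_ge0 ?powR_ge0.
have c0 : 0 <= c by rewrite !mulr_ge0 ?powR_ge0.
apply: (@le_trans _ _ (\int[P]_w ((1 - theta k)%:E * (enorm (e k w) `^ alpha)%:E
  + (b + c)%:E))%E).
  apply: ge0_le_integral => //.
  - by move=> w _; rewrite lee_fin addr_ge0 ?powR_ge0.
  - apply/measurable_EFinP; apply: measurable_funD => //.
    apply: measurableT_comp (measurable_powR _) _.
    apply: measurableT_comp measurable_enorm _.
    have /measurable_fun_pairP[mx mm] :=
      measurable_state xis x0 eta theta G_meas k.+1.
    have mg := measurableT_comp (measurable_gf gf_cont) mx.
    set h := (X in measurable_fun _ X).
    have -> : h = (fun w => (1 - theta k) *: m k w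
        + (- (1 - theta k)) *: grad f (x k.+1 w)).
      by apply/funext => w; rewrite /h scalerBr scaleNr.
    exact: measurable_lincomb.
  - apply: emeasurable_funD => //; apply: measurable_funeM.
    by apply/measurable_EFinP; exact: measurable_powR_err.
  - move=> w _; rewrite -EFinM -EFinD lee_fin addrA lerD2r.
    have := @err_contraction R n Xi f L1 L1_ge0 f_lip G x0 eta theta
      (fun j => xis j w) (fun j => ltW (eta_gt0 alpha j)) theta01 alpha k alpha_ge1.
    exact.
rewrite ge0_integralD//.
- rewrite ge0_integralZl//; last 3 first.
  + by apply/measurable_EFinP; exact: measurable_powR_err.
  + by move=> w _; rewrite lee_fin powR_ge0.
  + by rewrite lee_fin subr_ge0.
  by rewrite integral_cst//= probability_setT mule1.
- by move=> w _; rewrite -EFinM lee_fin mulr_ge0 ?powR_ge0 ?subr_ge0.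
- apply: measurable_funeM.
  by apply/measurable_EFinP; exact: measurable_powR_err.
- by move=> w _; rewrite lee_fin addr_ge0.
Qed.

Lemma mean_err_fin_num k : mean_err k \is a fin_num.
Proof.
rewrite ge0_fin_numE ?mean_err_ge0//.
elim: k => [|k IH]; first exact: le_lt_trans mean_err0 (ltry _).
apply: le_lt_trans (mean_errS_noise k) _.
have /fineK <- : mean_err k \is a fin_num by rewrite ge0_fin_numE ?mean_err_ge0.
by rewrite -EFinM -EFinD ltry.
Qed.

Let a k : R := fine (mean_err k).

(** After weighting, each inhomogeneous term is a constant over [k + 1]. *)
Lemma weighted_err_sum K :
  \sum_(k < K) weight_ alpha k * theta k * a k
    <= 2 * sigma `^ alpha
       + (L1 `^ alpha + 2 * sigma `^ alpha) * \sum_(k < K) k.+1%:R^-1.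
Proof.
pose b k := theta k `^ (1 - alpha) * (L1 `^ alpha * eta k `^ alpha)
      + 2 * (theta k `^ alpha * sigma `^ alpha).
have aE k : mean_err k = (a k)%:E by rewrite fineK// mean_err_fin_num.
have aS k : a k.+1 <= (1 - theta k) * a k + b k.
  by have := mean_errS_noise k; rewrite !aE -EFinM -EFinD lee_fin.
have a0 k : 0 <= a k by rewrite fine_ge0 ?mean_err_ge0.
have a02 : a 0 <= 2 * sigma `^ alpha by have := mean_err0; rewrite aE lee_fin.
have := @weighted_telescope R (weight_ alpha) theta a b K
  (fun k => ltW (weight_gt0 alpha k)) (weight_noninc alpha12) a0 aS.
move=> /le_trans; apply; rewrite weight0 mul1r; apply: lerD => //.
rewrite mulr_sumr; apply: ler_sum => k _; rewrite le_eqVlt; apply/orP; left; apply/eqP.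
rewrite /b mulrDr [RHS]mulrDl; congr (_ + _).
  rewrite -(weight_drift alpha12 k).
  by move: (weight_ _ k) (theta k `^ _) (eta k `^ _) => W t E; ring.
rewrite -(weight_noise alpha12 k).
by move: (weight_ _ k) (theta k `^ _) => W t; ring.
Qed.

Let C := (alpha - 1) * (2 / alpha) `^ (alpha / (alpha - 1)).
Let y := (2 * alpha - 1) / (3 * alpha - 2).

(** The factor [K^y] comes from bounding the step sizes below by [eta_(K-1)].
    Young's inequality trades [2 eta_k |e_k|] for the weighted power, whose mean
    [weighted_err_sum] controls. *)
Lemma path_grad_sum K w : (0 < K)%N ->
  \sum_(k < K) enorm (grad f (x k w))
  <= K%:R `^ y * (f x0 - flow + (C + L1) * \sum_(k < K) k.+1%:R^-1)
     + \sum_(k < K) K%:R `^ y * (weight_ alpha k * theta k) * enorm (e k w) `^ alpha.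
Proof.
move=> K0; have K0' : 0 < K%:R `^ y :> R by rewrite powR_gt0// ltr0n.
have KN : K%:R `^ y * K%:R `^ (- y) = 1 :> R.
  by rewrite powRN mulfV ?gt_eqF.
under [X in _ <= _ + X]eq_bigr do rewrite -mulrA.
rewrite -mulr_sumr -mulrDr; set S := leLHS; set Q := (X in _ <= _ * X).
suff H : K%:R `^ (- y) * S <= Q by rewrite -(ler_pM2l K0') mulrA KN mul1r in H.
apply: (@le_trans _ _ (\sum_(k < K) eta k * enorm (grad f (x k w)))).
  rewrite mulr_sumr; apply: ler_sum => k _.
  by rewrite ler_wpM2r ?enorm_ge0// eta_ge.
apply: le_trans (path_descent df L1_ge0 f_lip f_low G x0 theta _
  (fun k => ltW (eta_gt0 alpha k)) K) _.
rewrite /Q -[leRHS]addrA lerD2l mulr_sumr -big_split/=; apply: ler_sum => k _.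
have A0 : 0 < weight_ alpha k * theta k by rewrite mulr_gt0 ?weight_gt0 ?theta_gt0.
have alpha1 : 1 < alpha by case/andP: alpha12.
have := young_weighted (ltW (eta_gt0 alpha k)) A0 (enorm_ge0 (e k w)) alpha1.
rewrite weight_young// -/C => Y.
have H : L1 * eta k ^+ 2 <= L1 / k.+1%:R by rewrite ler_pM2l// sqr_eta_le.
apply: le_trans (lerD Y H) _.
by rewrite le_eqVlt; apply/orP; left; apply/eqP; ring.
Qed.

Lemma measurable_grad_norm k :
  measurable_fun setT (fun w => enorm (grad f (x k w))).
Proof.
have /measurable_fun_pairP[mx _] := measurable_state xis x0 eta theta G_meas k.
exact: (measurableT_comp measurable_enorm
  (measurableT_comp (measurable_gf gf_cont) mx)).
Qed.

Lemma mean_grad_sum K : (0 < K)%N ->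
  (\int[P]_w (\sum_(k < K) enorm (grad f (x k w)))%:E
    <= (K%:R `^ y * (f x0 - flow + 2 * sigma `^ alpha
         + (C + L1 + L1 `^ alpha + 2 * sigma `^ alpha)
           * \sum_(k < K) k.+1%:R^-1))%:E)%E.
Proof.
move=> K0; set H := \sum_(k < K) _^-1.
have H0 : 0 <= H by apply: sumr_ge0 => k _; rewrite invr_ge0.
have C0 : 0 <= C by rewrite mulr_ge0 ?powR_ge0// subr_ge0.
have D0 : 0 <= f x0 - flow by rewrite subr_ge0.
pose c k := K%:R `^ y * (weight_ alpha k * theta k).
have c0 k : 0 <= c k by rewrite !mulr_ge0 ?powR_ge0// ltW ?theta_gt0.
pose q := K%:R `^ y * (f x0 - flow + (C + L1) * H).
have q0 : 0 <= q.
  by rewrite mulr_ge0 ?powR_ge0// addr_ge0// mulr_ge0// addr_ge0.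
have me k : measurable_fun setT (fun w => (enorm (e k w) `^ alpha)%:E).
  by apply/measurable_EFinP; exact: measurable_powR_err.
have mc k : measurable_fun setT (fun w => (c k)%:E * (enorm (e k w) `^ alpha)%:E)%E.
  exact: measurable_funeM.
have ce0 k w : (0 <= (c k)%:E * (enorm (e k w) `^ alpha)%:E)%E.
  by rewrite -EFinM lee_fin mulr_ge0 ?powR_ge0.
apply: (@le_trans _ _ (\int[P]_w (q%:E
  + \sum_(k < K) (c k)%:E * (enorm (e k w) `^ alpha)%:E))%E).
  apply: ge0_le_integral => //.
  - by move=> w _; rewrite lee_fin sumr_ge0// => k _; exact: enorm_ge0.
  - apply/measurable_EFinP; apply: measurable_sum => k.
    exact: measurable_grad_norm.
  - by apply: emeasurable_funD => //; exact: emeasurable_sum.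
  - move=> w _; rewrite sumEFin -EFinD lee_fin.
    exact: path_grad_sum.
rewrite ge0_integralD//; last 2 first.
- by move=> w _; apply: sume_ge0 => k _; exact: ce0.
- exact: emeasurable_sum.
rewrite integral_cst//= probability_setT mule1 ge0_integral_sum//.
rewrite (eq_bigr (fun k : 'I_K => (c k * a k)%:E)); last first.
  move=> k _; rewrite ge0_integralZl//.
  - by rewrite [RHS]EFinM fineK// mean_err_fin_num.
  - by move=> w _; rewrite lee_fin powR_ge0.
  - by rewrite lee_fin.
rewrite sumEFin -EFinD lee_fin /q /c.
under [X in _ + X]eq_bigr do rewrite -mulrA.
rewrite -mulr_sumr -mulrDr ler_wpM2l ?powR_ge0//.
by have := weighted_err_sum K; rewrite -/H; lra.
Qed.

End convergence.

(** * The constants of the complexity bound *)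

Section complexity.
Context {R : realType}.
Variables (alpha sigma L1 f0 flow : R).
Hypothesis alpha12 : 1 < alpha <= 2.
Hypothesis L1_gt0 : 0 < L1.
Hypothesis f0_low : flow <= f0.

Let M := M1 alpha f0 flow sigma L1.
Let C := (alpha - 1) * (2 / alpha) `^ (alpha / (alpha - 1)).
Let s := (alpha - 1) / (3 * alpha - 2).

Let alpha_gt1 : 1 < alpha. Proof. by case/andP: alpha12. Qed.
Let alpha_le2 : alpha <= 2. Proof. by case/andP: alpha12. Qed.

Lemma young_const_ge : alpha - 1 <= C.
Proof.
rewrite /C -[leLHS]mulr1 ler_wpM2l ?subr_ge0 ?(ltW alpha_gt1)//.
rewrite -[leLHS](powRr0 (2 / alpha)) ler_powR//.
  by rewrite ler_pdivlMr ?mul1r//; have := alpha_gt1; lra.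
by rewrite divr_ge0 ?subr_ge0 ?(ltW alpha_gt1)//; have := alpha_gt1; lra.
Qed.

Lemma M1_ge : 2 * (alpha - 1) <= M.
Proof.
have := young_const_ge; rewrite /M /M1 -/C.
have := powR_ge0 sigma alpha; have := powR_ge0 L1 alpha.
by have := f0_low; have := L1_gt0; lra.
Qed.

(** Once [1 <= ln K], the harmonic sum is at most [2 ln K] and every
    nonnegative constant is at most [ln K] times itself; the factor [2] in [M1] absorbs the former. *)
Lemma descent_budget K : (0 < K)%N -> 1 <= ln (K%:R : R) ->
  f0 - flow + 2 * sigma `^ alpha
    + (C + L1 + L1 `^ alpha + 2 * sigma `^ alpha) * \sum_(k < K) k.+1%:R^-1
  <= M * ln K%:R.
Proof.
move=> K0 l1; have := @harmonic_le_ln R K K0.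
have := young_const_ge; rewrite /M /M1 -/C.
have := powR_ge0 sigma alpha; have := powR_ge0 L1 alpha.
have := alpha_gt1; have := L1_gt0; have := f0_low; move: l1.
move: C (sigma `^ _) (L1 `^ _) (ln _) (\sum_(k < K) _) => c u v l H.
move=> l1 D0 L0 a1 v0 u0 ca Hl.
have h1 : 0 <= (c + L1 + v + 2 * u) * (2 * l - H) by rewrite mulr_ge0//; lra.
have h2 : 0 <= (f0 - flow + 2 * u) * (l - 1) by rewrite mulr_ge0//; lra.
have h3 : 0 <= (f0 - flow) * l by rewrite mulr_ge0//; lra.
have h4 : 0 <= v * l by rewrite mulr_ge0//; lra.
nra.
Qed.

(** The maximum with [3] makes [1 <= ln K]. The threshold lemma also needs
    [1 <= c]; this holds because [M1 / (alpha - 1)] is at least [2], by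
    [M1_ge]. *)
Lemma K_bound_suffices eps K : 0 < eps < 1 -> K_bound alpha M eps <= K%:R ->
  [/\ (0 < K)%N, 1 <= ln (K%:R : R) & M * ln K%:R <= eps * K%:R `^ s].
Proof.
move=> /andP[e0 e1]; rewrite /K_bound ge_max => /andP[cK K3].
have K0 : (0 < K)%N by rewrite -(ltr0n R); lra.
have D0 : 0 < 3 * alpha - 2 by have := alpha_gt1; lra.
have a0 : 0 < alpha - 1 by have := alpha_gt1; lra.
have M0 : 0 < M by have := M1_ge; lra.
have s0 : 0 < s by rewrite divr_gt0.
split => //; first exact: ln_ge1.
apply: log_threshold => //.
  rewrite ler_pdivlMr ?mul1r; last by rewrite mulr_gt0.
  rewrite /s mulrAC ler_pdivrMr//.
  have := M1_ge; move: M0 D0 a0 => ? ? ? ?.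
  have h1 : 0 <= (M - 2 * (alpha - 1)) * (3 * alpha - 2) by rewrite mulr_ge0//; lra.
  have h2 : (alpha - 1) * eps <= alpha - 1 by rewrite ler_piMr//; lra.
  nra.
have -> : 2 * M / (s * eps) = 2 * (3 * alpha - 2) * M / ((alpha - 1) * eps).
  by rewrite /s; field; rewrite !gt_eqF.
by rewrite /s invf_div.
Qed.

End complexity.

Theorem theorem1 (R : realType) (n : nat)
  (d : measure_display) (T : measurableType d) (P : probability T R)
  (d' : measure_display) (Xi : measurableType d')
  (f : 'rV[R]_n -> R) (G : 'rV[R]_n -> Xi -> 'rV[R]_n)
  (xi : {RV P >-> Xi}) (xis : nat -> {RV P >-> Xi})
  (x0 : 'rV[R]_n) (flow L1 sigma alpha : R)
  (* smooth problem with an optimal solution *)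
  (f_C1 : cont_diff f)
  (f_opt : exists xstar, forall x, f xstar <= f x)
  (* measurable stochastic gradient estimator *)
  (G_meas : measurable_fun [set: borel_rV R n * Xi]
     (fun p : borel_rV R n * Xi => (G p.1 p.2 : borel_rV R n)))
  (* Basic Assumptions (a), (b), (c) *)
  (f_low : forall x, flow <= f x)
  (L1_gt0 : 0 < L1)
  (f_lip : forall x y, enorm (grad f x - grad f y) <= L1 * enorm (x - y))
  (sigma_gt0 : 0 < sigma)
  (alpha_gt1 : 1 < alpha) (alpha_le2 : alpha <= 2)
  (G_int : forall x (i : 'I_n),
     P.-integrable setT (fun w => (G x (xi w) 0 i)%:E))
  (G_unbiased : forall x (i : 'I_n),
     ('E_P[fun w => G x (xi w) 0%R i] = (grad f x 0%R i)%:E)%E)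
  (G_moment : forall x,
     ('E_P[fun w => (enorm (G x (xi w) - grad f x) `^ alpha)%R]
        <= (sigma `^ alpha)%:E)%E)
  (* independent samples of xi *)
  (xis_law : forall k, same_law (xis k) xi)
  (xis_indep : mutually_independent P (fun k => sigma_rv (xis k))) :
  let x k w := sfom_x G x0 (eta_ alpha) (theta_ alpha) (fun j => xis j w) k in
  let m k w := sfom_m G x0 (eta_ alpha) (theta_ alpha) (fun j => xis j w) k in
  (* the iteration is well defined *)
  {ae P, forall w, forall k, m k w != 0} ->
  forall (eps : R), 0 < eps < 1 ->
  forall (K : nat),
    K%:R >= K_bound alpha (M1 alpha (f x0) flow sigma L1) eps ->
  forall (iota : {RV P >-> nat}),
    uniform_below K iota ->
    independent2 P (sigma_rv iota) (sigma_seq (fun k => xis k : T -> Xi)) ->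
    ('E_P[fun w => enorm (grad f (x (iota w) w))] <= eps%:E)%E.
Proof.
move=> x m _ eps eps01 K KK iota uK iota_indep.
have alpha12 : 1 < alpha <= 2 by rewrite alpha_gt1.
have gf_cont : continuous (grad f) by case: f_C1.
have [K0 lnK MK] := K_bound_suffices alpha12 L1_gt0 (f_low x0) eps01 KK.
have unbiased y i : (\int[P]_w (G y (xi w) 0%R i)%:E = (grad f y 0%R i)%:E)%E.
  by have := G_unbiased y i; rewrite unlock.
have moment y :
    (\int[P]_w (enorm (G y (xi w) - grad f y) `^ alpha)%:E <= (sigma `^ alpha)%:E)%E.
  by have := G_moment y; rewrite unlock.
have mx k : measurable_fun setT (fun w => enorm (grad f (x k w))).
  exact: (measurable_grad_norm xis x0 alpha f_C1 G_meas k).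
have ind k A B : measurable B ->
    (P (iota @^-1` A `&` (fun w => enorm (grad f (x k w))) @^-1` B)
      = P (iota @^-1` A) * P ((fun w => enorm (grad f (x k w))) @^-1` B))%E.
  move=> mB; apply: iota_indep; first by exists A => //; rewrite setTI.
  have mgf : measurable_fun setT (fun y : borel_rV R n => enorm (grad f y)).
    exact: (measurableT_comp measurable_enorm (measurable_gf gf_cont)).
  have mS : measurable_fun setT
      (fun y : borel_rV R n * borel_rV R n => enorm (grad f y.1)).
    exact: (measurableT_comp mgf measurable_fst).
  have mSB := mS measurableT B mB; rewrite setTI in mSB.
  have := @measurable_sfom_state_past _ _ _ _ _ G_meas x0 (eta_ alpha)
    (theta_ alpha) _ _ (fun j => xis j : T -> Xi) k _ mSB.
  apply: smallest_sub; first exact: smallest_sigma_algebra.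
  by move=> C [j _ Cj]; apply: sub_sigma_algebra; exists j.
rewrite unlock (mean_uniform_index K0 uK mx (fun k w => enorm_ge0 _) ind).
have gsum : (\int[P]_w (\sum_(k < K) enorm (grad f (x k w)))%:E <= _)%E :=
  @mean_grad_sum R n d T P d' Xi f G xi xis x0 flow L1 sigma alpha f_C1 G_meas
    f_low L1_gt0 f_lip alpha12 G_int unbiased moment xis_law xis_indep K K0.
have Q := @descent_budget R alpha sigma L1 (f x0) flow alpha12 L1_gt0 (f_low x0)
  K K0 lnK.
have K0' : 0 < K%:R :> R by rewrite ltr0n.
apply: (@le_trans _ _ ((K%:R^-1)%:E * (eps * K%:R)%:E)%E); last first.
  by rewrite -EFinM lee_fin mulrC mulfK// gt_eqF.
rewrite lee_pmul2l ?lte_fin ?invr_gt0//; apply: le_trans gsum _.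
rewrite lee_fin; apply: le_trans (ler_wpM2l (powR_ge0 _ _) (le_trans Q MK)) _.
rewrite mulrCA -powRD; last by rewrite (gt_eqF K0') implybT.
have -> : (2 * alpha - 1) / (3 * alpha - 2) + (alpha - 1) / (3 * alpha - 2) = 1.
  by field; rewrite gt_eqF//; lra.
by rewrite powRr1 ?(ltW K0').
Qed.
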